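(* Let $\mu$ and $\nu$ be probability measures on the real line, all of whose moments are finite. Then for every $n\ge 0$, $$\widehat{\mu}\star\widehat{\nu}(s)=\begin{cases}(\mu\star\nu)_n & \text{if } s=z^n,\\ (\mu\uplus\nu)_n & \text{if } s=w^n,\end{cases}$$ i.e. the moments of the filtered convolution restricted to the cyclic subsemigroups $S(z)=FS(\{z\})$ and $S(w)=FS(\{w\})$ agree with the moments of the classical convolution $\mu\star\nu$ and of the boolean convolution $\mu\uplus\nu$, respectively.
   Context: $S=FS(\{z,w\})$ is the free semigroup of all finite words in $z,w$ including the empty word $1$. $\mathcal{B}=\mathbf{C}\langle X,X',P\rangle$ is the unital *-algebra of polynomials in noncommuting self-adjoint $X,X'$ and a projection $P$ ($P^*=P^2=P$), with coproduct the unital *-homomorphism $\Delta:\mathcal{B}\to\mathcal{B}\otimes\mathcal{B}$ given by $\Delta(X)=X\otimes 1+1\otimes X$, $\Delta(X')=X'\otimes P+P\otimes X'$, $\Delta(P)=P\otimes P$. Write $X(z)=X$, $X(w)=X'$. For a probability measure $\mu$ on $\mathbf{R}$ with all moments finite, with moments $\mu_n$, let $\phi$ be the state on $\mathbf{C}[Y]$ ($Y=Y^*$) with $\phi(Y^n)=\mu_n$. Its boolean extension $\widetilde{\phi}$ is the state on $\mathbf{C}\langle Y,P\rangle$ ($P$ a projection) given by $\widetilde{\phi}(P^{\alpha}Y^{n_1}PY^{n_2}P\cdots PY^{n_k}P^{\beta})=\phi(Y^{n_1})\cdots\phi(Y^{n_k})$ for $\alpha,\beta\in\{0,1\}$, $n_i\in\mathbf{N}$,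 and $\widetilde{\phi}(P)=1$. Let $\eta:\mathcal{B}\to\mathbf{C}\langle Y,P\rangle$ be the unital *-homomorphism with $\eta(X)=\eta(X')=Y$, $\eta(P)=P$. Then $\widehat{\mu}:=\widetilde{\phi}\circ\eta$, and $\widehat{\nu}$ is defined from $\nu$ in the same way. The filtered convolution is $\widehat{\mu}\star\widehat{\nu}=(\widehat{\mu}\otimes\widehat{\nu})\circ\Delta$, and $\widehat{\mu}\star\widehat{\nu}(s):=\widehat{\mu}\star\widehat{\nu}(X(s_1)\cdots X(s_n))$ for $s=s_1\ldots s_n\in S$. For a measure $\sigma$, $\sigma_n$ denotes its $n$-th moment. The boolean convolution $\mu\uplus\nu$ is the usual one of Speicher and Woroudi: the probability measure with $K_{\mu\uplus\nu}=K_\mu+K_\nu$, where $K_\sigma(\zeta)=\zeta-1/G_\sigma(\zeta)$ and $G_\sigma(\zeta)=\int_{\mathbf{R}}(\zeta-x)^{-1}d\sigma(x)$. *)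

(* Defs.v *)
From HB Require Import structures.
From mathcomp Require Import all_boot all_order all_algebra.
From mathcomp Require Import finmap monalg complex.
From mathcomp Require Import all_classical all_reals all_analysis.
From mathcomp Require Import measurable_realfun.

Set Implicit Arguments.
Unset Strict Implicit.
Unset Printing Implicit Defensive.

Import Order.TTheory GRing.Theory Num.Theory.

Local Open Scope ring_scope.
Local Open Scope complex_scope.

(** * Words in letters [I] and an idempotent letter

    [Some i] stands for the letter [i] and [None] for [P]. A word is reduced
    when it has no factor [PP]; reduced words represent the monoid presented by
    the letters and the relation [P P = P]. *)

Section Words.
Variable I : choiceType.
Implicit Types (a : option I) (s t : seq (option I)).

Definition reduced s := sorted (fun a b : option I => a || b) s.

Record pword := PWord { pword_val :> seq (option I); _ : reduced pword_val }.

HB.instance Definition _ := [isSub for pword_val].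
HB.instance Definition _ := [Choice of pword by <:].

Definition pcons a s : seq (option I) :=
  if a is None then if s is None :: _ then s else None :: s else a :: s.

Definition wmul s t := foldr pcons t s.

Lemma pcons_reduced a s : reduced s -> reduced (pcons a s).
Proof. by case: a => [i|]; case: s => [|[j|] s]. Qed.

Lemma wmul_reduced s t : reduced t -> reduced (wmul s t).
Proof. by move=> rt; elim: s => //= a s; exact: pcons_reduced. Qed.

Lemma reduced_behead a s : reduced (a :: s) -> reduced s.
Proof. by case: s => [//|b s] /= /andP[]. Qed.

Lemma pcons_id a s : reduced (a :: s) -> pcons a s = a :: s.
Proof. by case: a => [i|] //; case: s => [|[j|] s]. Qed.

Lemma wmul_nil s : reduced s -> wmul s [::] = s.
Proof.
elim: s => //= a s IH rs; rewrite IH; last exact: reduced_behead rs.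
exact: pcons_id.
Qed.

Lemma wmul_pcons a s t : wmul (pcons a s) t = pcons a (wmul s t).
Proof.
case: a => [i|] //; case: s => [|[j|] s] //=.
by case: (wmul s t) => [|[j|] u].
Qed.

Lemma wmulA : associative wmul.
Proof. by move=> s t u; elim: s => //= a s ->; rewrite wmul_pcons. Qed.

Lemma pcons_neq0 a s : pcons a s <> [::].
Proof. by case: a => [i|] //; case: s => [|[j|] s]. Qed.

Definition pw1 : pword := @PWord [::] isT.
Definition pwmul (u v : pword) : pword := PWord (wmul_reduced u (valP v)).

Fact pwmulA : associative pwmul.
Proof. by move=> u v w; apply: val_inj; exact: wmulA. Qed.

Fact pwmul1 : left_id pw1 pwmul.
Proof. by move=> u; apply: val_inj. Qed.

Fact pwmulr1 : right_id pw1 pwmul.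
Proof. by move=> u; apply: val_inj; apply: wmul_nil; exact: valP. Qed.

Fact pwmul_unit u v : pwmul u v = pw1 -> u = pw1 /\ v = pw1.
Proof.
case: u v => [[|a s] rs] [t rt] /(congr1 val)/= h.
  by split; apply: val_inj.
by case: (@pcons_neq0 a (wmul s t)).
Qed.

HB.instance Definition _ :=
  Choice_isMonomialDef.Build pword pwmulA pwmul1 pwmulr1 pwmul_unit.

Definition pwletter a : pword := @PWord [:: a] isT.

Lemma reduced_rev s : reduced (rev s) = reduced s.
Proof.
rewrite /reduced rev_sorted; case: s => //= a s.
by apply: eq_path => x y; rewrite orbC.
Qed.

Definition pwrev (u : pword) : pword :=
  @PWord (rev u) (etrans (reduced_rev u) (valP u)).

Lemma pwrevK : involutive pwrev.
Proof. by move=> u; apply: val_inj; rewrite /= revK. Qed.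

Lemma wmul_cat s t u : wmul (s ++ t) u = wmul s (wmul t u).
Proof. exact: foldr_cat. Qed.

Lemma rev_pcons a t : reduced t ->
  rev (pcons a t) = wmul (rev t) (wmul [:: a] [::]).
Proof.
move=> rt.
have aux : pcons a t = a :: t ->
    rev (pcons a t) = wmul (rev t) (wmul [:: a] [::]).
  move=> e; rewrite -wmul_cat wmul_nil ?e ?rev_cons ?cats1//.
  by rewrite -rev_cons reduced_rev -e pcons_reduced.
case: a aux => [i|] aux; first exact: aux.
case: t rt aux => [|[j|] t] rt aux; [exact: aux|exact: aux|].
rewrite /= -[LHS]wmul_nil ?reduced_rev//.
by rewrite rev_cons -cats1 !wmul_cat.
Qed.

Lemma rev_wmul s t : reduced t ->
  rev (wmul s t) = wmul (rev t) (wmul (rev s) [::]).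
Proof.
move=> rt; elim: s => [|a s IH] /=; first by rewrite wmul_nil ?reduced_rev.
rewrite rev_pcons ?wmul_reduced// IH -!wmulA; congr wmul.
by rewrite rev_cons -cats1 wmul_cat.
Qed.

Lemma pwrevM (u v : pword) : pwrev (mmul u v) = mmul (pwrev v) (pwrev u).
Proof.
apply: val_inj; rewrite /= rev_wmul; last exact: valP.
by rewrite (wmul_nil (s := rev u)) // reduced_rev; exact: valP.
Qed.

(** The lengths of the blocks of letters separated by the [P]'s; a [P] at an end
    of the word may contribute a block of length 0. *)
Fixpoint runs s : seq nat :=
  match s with
  | [::] => [::]
  | None :: s' => 0%N :: runs s'
  | Some _ :: s' => if runs s' is n :: r then n.+1 :: r else [:: 1%N]
  end.

End Words.

Section ProdMonom.
Variables K L : monomType.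
Let one : K * L := (mone, mone).
Let mul (u v : K * L) : K * L := (mmul u.1 v.1, mmul u.2 v.2).
Fact prod_mulmA : associative mul.
Proof. by move=> u v w; rewrite /mul !mulmA. Qed.
Fact prod_mul1m : left_id one mul.
Proof. by case=> k l; rewrite /mul/= !mul1m. Qed.
Fact prod_mulm1 : right_id one mul.
Proof. by case=> k l; rewrite /mul/= !mulm1. Qed.
Fact prod_unitm u v : mul u v = one -> u = one /\ v = one.
Proof.
case: u v => [u1 u2] [v1 v2] [/unitm[-> ->] /unitm[-> ->]]; by split.
Qed.
HB.instance Definition _ :=
  Choice_isMonomialDef.Build (K * L)%type prod_mulmA prod_mul1m prod_mulm1 prod_unitm.
End ProdMonom.

HB.lock Definition linext (C : numClosedFieldType) (K : choiceType)
    (V : lmodType C) (h : K -> V) (g : {malg C[K]}) : V :=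
  \sum_(k <- msupp g) g@_k *: h k.

Section LinExt.
Variables (C : numClosedFieldType) (K : choiceType) (V : lmodType C) (h : K -> V).
Local Notation linext := (linext h).

Lemma linextEw (d : {fset K}) g : (msupp g `<=` d)%fset ->
  linext g = \sum_(k <- d) g@_k *: h k.
Proof.
move=> sgd; rewrite linext.unlock (big_fset_incl _ sgd)//.
by move=> k _ /mcoeff_outdom ->; rewrite scale0r.
Qed.

Lemma linext_is_linear : linear linext.
Proof.
move=> c f g; pose d := (msupp f `|` msupp g)%fset.
have sub : (msupp (c *: f + g) `<=` d)%fset.
  apply: fsubset_trans (msuppD_le _ _) _.
  by apply: fsetSU; exact: msuppZ_le.
rewrite (linextEw sub) (@linextEw d f) ?fsubsetUl//.
rewrite (@linextEw d g) ?fsubsetUr// scaler_sumr -big_split/=.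
by apply: eq_bigr => k _; rewrite mcoeffD mcoeffZ scalerDl scalerA.
Qed.

HB.instance Definition _ := GRing.isLinear.Build C {malg C[K]} V _ linext
  linext_is_linear.

Lemma linextU (c : C) k : linext << c *g k >> = c *: h k.
Proof.
rewrite (@linextEw [fset k]%fset) ?msuppU_le// big_seq_fset1.
by rewrite mcoeffUU.
Qed.

End LinExt.

Lemma malgUZ (C : numClosedFieldType) (K : choiceType) (c : C) (k : K) :
  << c *g k >> = c *: << k >> :> {malg C[K]}.
Proof. by apply/malgP => l; rewrite mcoeffZ !mcoeffU mulrnAr mulr1. Qed.

Lemma malg_linear_ext (C : numClosedFieldType) (K : choiceType)
    (V : lmodType C) (f g : {linear {malg C[K]} -> V}) :
  (forall k, f << k >> = g << k >>) -> f =1 g.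
Proof.
move=> fg x; rewrite (monalgE x) !raddf_sum; apply: eq_bigr => k _.
by rewrite /= malgUZ !linearZ_LR /= fg.
Qed.

Lemma malg_scaleAr (C : numClosedFieldType) (K : monomType) (c : C)
  (f g : {malg C[K]}) : c *: (f * g) = f * (c *: g).
Proof.
apply/malgP => k; rewrite mcoeffZ.
rewrite (@mcoeffMlw _ _ (msupp f) (msupp g)) ?fsubset_refl//.
rewrite (@mcoeffMlw _ _ (msupp f) (msupp g)) ?fsubset_refl ?msuppZ_le//.
rewrite mulr_sumr; apply: eq_bigr => i _; rewrite mulr_sumr.
apply: eq_bigr => j _; rewrite mcoeffZ mulrnAr; congr (_ *+ _).
by rewrite mulrCA.
Qed.

HB.lock Definition mstar (C : numClosedFieldType) (K : choiceType)
    (r : K -> K) (g : {malg C[K]}) : {malg C[K]} :=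
  \sum_(k <- msupp g) << (g@_k)^* *g r k >>.

Section Star.
Variables (C : numClosedFieldType) (K : choiceType) (r : K -> K).
Local Notation mstar := (@mstar C K r).

Lemma mstarEw (d : {fset K}) g : (msupp g `<=` d)%fset ->
  mstar g = \sum_(k <- d) << (g@_k)^* *g r k >>.
Proof.
move=> sgd; rewrite mstar.unlock (big_fset_incl _ sgd)//.
by move=> k _ /mcoeff_outdom ->; rewrite rmorph0 monalgU0.
Qed.

Lemma mstar_is_additive : zmod_morphism mstar.
Proof.
move=> f g; pose d := (msupp f `|` msupp g)%fset.
rewrite (@mstarEw d (f - g)) ?msuppB_le// (@mstarEw d f) ?fsubsetUl//.
rewrite (@mstarEw d g) ?fsubsetUr// -sumrB.
by apply: eq_bigr => k _; rewrite mcoeffB rmorphB/= monalgUB.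
Qed.

HB.instance Definition _ := GRing.isZmodMorphism.Build {malg C[K]} {malg C[K]}
  mstar mstar_is_additive.

Lemma mstarU c k : mstar << c *g k >> = << c^* *g r k >>.
Proof.
rewrite (@mstarEw [fset k]%fset) ?msuppU_le// big_seq_fset1.
by rewrite mcoeffUU.
Qed.

Lemma mstarZ c g : mstar (c *: g) = c^* *: mstar g.
Proof.
rewrite (@mstarEw (msupp g)) ?msuppZ_le// mstar.unlock scaler_sumr.
apply: eq_bigr => k _; rewrite mcoeffZ rmorphM/=.
by apply/malgP => l; rewrite mcoeffZ !mcoeffU mulrnAr.
Qed.

Lemma mstar_semilinear c f g :
  mstar (c *: f + g) = c^* *: mstar f + mstar g.
Proof. by rewrite raddfD /= mstarZ. Qed.

Lemma mstarK : involutive r -> involutive mstar.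
Proof.
move=> rK g; rewrite [RHS]monalgE.
have -> : mstar g = \sum_(k <- msupp g) << (g@_k)^* *g r k >> by rewrite mstar.unlock.
by rewrite raddf_sum; apply: eq_bigr => k _; rewrite /= mstarU conjCK rK.
Qed.

End Star.

Lemma mstarM (C : numClosedFieldType) (K : monomType) (r : K -> K) :
  {morph r : u v / mmul u v >-> mmul v u} ->
  forall f g : {malg C[K]}, mstar r (f * g) = mstar r g * mstar r f.
Proof.
move=> rM f g; rewrite (monalgE f) (monalgE g).
rewrite mulr_suml !raddf_sum mulr_sumr; apply: eq_bigr => i _.
rewrite mulr_sumr !raddf_sum mulr_suml; apply: eq_bigr => j _.
have UU a b (u v : K) : << a *g u >> * << b *g v >> = << a * b *g mmul u v >>
    :> {malg C[K]} by rewrite malgM_def fgmulUU.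
by rewrite /= UU !mstarU UU rM rmorphM/= mulrC.
Qed.

(** * The *-algebra C<I, P>: noncommuting self-adjoint variables indexed by [I]
      and a projection [P] *)

Section NCPoly.
Variables (C : numClosedFieldType) (I : choiceType).

Definition ncpoly := {malg C[pword I]}.

HB.instance Definition _ := GRing.Lalgebra.on ncpoly.

Fact ncpoly_scaleAr (c : C) (f g : ncpoly) : c *: (f * g) = f * (c *: g).
Proof. exact: malg_scaleAr. Qed.

HB.instance Definition _ :=
  GRing.Lalgebra_isAlgebra.Build C ncpoly ncpoly_scaleAr.

Definition ncstar : ncpoly -> ncpoly := mstar (@pwrev I).

End NCPoly.

HB.lock Definition ncX (C : numClosedFieldType) (I : choiceType) (i : I) :
  ncpoly C I := << pwletter (Some i) >>.

HB.lock Definition ncP (C : numClosedFieldType) (I : choiceType) :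
  ncpoly C I := << pwletter None >>.

Arguments ncX {C I} i.
Arguments ncP {C I}.

Section NCEval.
Variables (C : numClosedFieldType) (I : choiceType) (A : algType C).
Variables (x : I -> A) (p : A).

(** A unital homomorphism as soon as [p] is idempotent; the only one sending
    [ncX i] to [x i] and [ncP] to [p] ([nceval_unique]). *)
Definition nceval : ncpoly C I -> A :=
  linext (fun w : pword I => \prod_(a <- (w : seq _)) oapp x p a).

HB.instance Definition _ := GRing.Linear.on nceval.

Lemma ncevalU c (w : pword I) :
  nceval << c *g w >> = c *: \prod_(a <- (w : seq _)) oapp x p a.
Proof. exact: linextU. Qed.

Lemma ncevalX i : nceval (ncX i) = x i.
Proof. by rewrite ncX.unlock ncevalU scale1r big_seq1. Qed.

Lemma ncevalP : nceval ncP = p.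
Proof. by rewrite ncP.unlock ncevalU scale1r big_seq1. Qed.

Hypothesis pp : p * p = p.

Lemma nceval_is_multiplicative : monoid_morphism nceval.
Proof.
split.
  by rewrite (_ : 1 = << pw1 I >>)// ncevalU scale1r big_nil.
move=> f g; rewrite (monalgE f) (monalgE g).
rewrite mulr_suml !raddf_sum mulr_suml; apply: eq_bigr => u _.
rewrite mulr_sumr !raddf_sum mulr_sumr; apply: eq_bigr => v _.
rewrite /= malgM_def fgmulUU !ncevalU -scalerAl -scalerAr scalerA.
congr (_ *: _) => /=; elim: (pword_val u) => [|a s IH] /=.
  by rewrite big_nil mul1r.
rewrite big_cons -mulrA -IH; case: a => [i|] /=; first by rewrite big_cons.
case: (wmul s v) => [|[j|] t]; rewrite !big_cons//=.
by rewrite mulrA pp.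
Qed.

End NCEval.

Lemma ncpoly_ind (C : numClosedFieldType) (I : choiceType)
    (Q : ncpoly C I -> Prop) :
  Q 1 -> Q ncP -> (forall i, Q (ncX i)) ->
  (forall c f g, Q f -> Q g -> Q (c *: f + g)) ->
  (forall f g, Q f -> Q g -> Q (f * g)) -> forall f, Q f.
Proof.
move=> Q1 QP QX QD QM f.
have Q0 : Q 0 by rewrite -[0](addNr 1) -scaleN1r; exact: QD.
have Qw (w : pword I) : Q << w >>.
  case: w => s; elim: s => [|a s IH] rs.
    by rewrite (_ : PWord rs = pw1 I) //; apply: val_inj.
  have rs' := reduced_behead rs.
  have -> : << PWord rs >> = << pwletter a >> * << PWord rs' >> :> ncpoly C I.
    rewrite malgM_def fgmulUU mulr1; congr << _ >>.
    by apply: val_inj; rewrite /= pcons_id.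
  apply: QM (IH _).
  by case: a {rs} => [i|]; [move: (QX i); rewrite ncX.unlock|move: QP; rewrite ncP.unlock].
rewrite (monalgE f); elim/big_rec: _ => // w g _ Qg.
by rewrite malgUZ; exact: QD.
Qed.

Lemma nceval_unique (C : numClosedFieldType) (I : choiceType) (A : algType C)
    (x : I -> A) (p : A) (f : {lrmorphism ncpoly C I -> A}) :
  (forall i, f (ncX i) = x i) -> f ncP = p -> f =1 nceval x p.
Proof.
move=> fx fp.
have pp : p * p = p.
  rewrite -fp -rmorphM; congr (f _).
  by rewrite ncP.unlock malgM_def fgmulUU mulr1; congr << _ >>; apply: val_inj.
have [ev1 evM] := nceval_is_multiplicative x pp.
apply: ncpoly_ind.
- by rewrite rmorph1 ev1.
- by rewrite fp ncevalP.
- by move=> i; rewrite fx ncevalX.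
- move=> c g h eg eh; rewrite [LHS]linearP [RHS]linearP.
  congr (_ *: _ + _); [exact: eg|exact: eh].
- by move=> g h eg eh; rewrite evM -eg -eh; exact: rmorphM.
Qed.

Section NCPolyTheory.
Variables (C : numClosedFieldType) (I : choiceType).
Local Notation star := (@ncstar C I).

Lemma ncPP : ncP * ncP = ncP :> ncpoly C I.
Proof.
by rewrite ncP.unlock malgM_def fgmulUU mulr1; congr << _ >>; apply: val_inj.
Qed.

Lemma ncstarX i : star (ncX i) = ncX i.
Proof. rewrite /ncstar ncX.unlock [LHS]mstarU rmorph1; congr << _ >>; exact: val_inj. Qed.

Lemma ncstarP : star ncP = ncP.
Proof. rewrite /ncstar ncP.unlock [LHS]mstarU rmorph1; congr << _ >>; exact: val_inj. Qed.

Lemma ncstar1 : star 1 = 1.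
Proof. rewrite /ncstar [LHS]mstarU rmorph1; congr << _ >>; exact: val_inj. Qed.

Lemma ncstarK : involutive star.
Proof. exact: mstarK (@pwrevK I). Qed.

Lemma ncstarM f g : star (f * g) = star g * star f.
Proof. exact: (mstarM (@pwrevM I)). Qed.

Lemma ncstarP_lin (c : C) f g : star (c *: f + g) = c^* *: star f + star g.
Proof. exact: mstar_semilinear. Qed.

End NCPolyTheory.

(** * Tensor product of two such algebras

    The monoid algebra of the product of the two monoids; [tens_lift_unique]
    is its universal property with respect to bilinear maps. *)

Section Tensor.
Variables (C : numClosedFieldType) (I J : choiceType).
Local Notation A := (ncpoly C I).
Local Notation B := (ncpoly C J).

Definition tensor := {malg C[(pword I * pword J)%type]}.

HB.instance Definition _ := GRing.Lalgebra.on tensor.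

Fact tensor_scaleAr (c : C) (f g : tensor) : c *: (f * g) = f * (c *: g).
Proof. exact: malg_scaleAr. Qed.

HB.instance Definition _ :=
  GRing.Lalgebra_isAlgebra.Build C tensor tensor_scaleAr.

Definition tens (a : A) (b : B) : tensor :=
  linext (fun u : pword I => linext (fun v : pword J => << (u, v) >> : tensor) b) a.

Definition tensstar : tensor -> tensor :=
  mstar (fun uv : pword I * pword J => (pwrev uv.1, pwrev uv.2)).

Definition tensr (b : B) (a : A) := tens a b.

Lemma tens_linl b : linear (tens ^~ b).
Proof. exact: linearP. Qed.

Lemma tens_linr a : linear (tens a).
Proof.
move=> c f g; rewrite /tens !(linextEw _ (fsubset_refl (msupp a))).
rewrite scaler_sumr -big_split/=; apply: eq_bigr => u _.
by rewrite linearP scalerDr !scalerA mulrC.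
Qed.

HB.instance Definition _ b := GRing.isLinear.Build C A tensor _ (tensr b)
  (tens_linl b).
HB.instance Definition _ a := GRing.isLinear.Build C B tensor _ (tens a)
  (tens_linr a).

Lemma tens_suml T (r : seq T) (F : T -> A) b :
  tens (\sum_(i <- r) F i) b = \sum_(i <- r) tens (F i) b.
Proof. exact: (raddf_sum (tensr b)). Qed.

Lemma tens_sumr T (r : seq T) (F : T -> B) a :
  tens a (\sum_(i <- r) F i) = \sum_(i <- r) tens a (F i).
Proof. exact: (raddf_sum (tens a)). Qed.

Lemma tensU u v : tens << u >> << v >> = << (u, v) >>.
Proof. by rewrite /tens !linextU !scale1r. Qed.

Lemma tens11 : tens 1 1 = 1.
Proof. exact: tensU. Qed.

Lemma tensUU c d u v :
  tens << c *g u >> << d *g v >> = << c * d *g (u, v) >>.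
Proof. by rewrite /tens !linextU scalerA -malgUZ. Qed.

Lemma tensM a b a' b' : tens a b * tens a' b' = tens (a * a') (b * b').
Proof.
rewrite (monalgE a) tens_suml !mulr_suml tens_suml; apply: eq_bigr => u _.
rewrite (monalgE a') tens_suml !mulr_sumr tens_suml; apply: eq_bigr => u' _.
rewrite (monalgE b) tens_sumr !mulr_suml tens_sumr; apply: eq_bigr => v _.
rewrite (monalgE b') tens_sumr !mulr_sumr tens_sumr; apply: eq_bigr => v' _.
rewrite !tensUU !malgM_def !fgmulUU tensUU; congr << _ *g _ >>.
by rewrite mulrACA.
Qed.

Lemma tensstar_sum T (r : seq T) (F : T -> tensor) :
  tensstar (\sum_(i <- r) F i) = \sum_(i <- r) tensstar (F i).
Proof. exact: (raddf_sum (mstar _)). Qed.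

Lemma ncstar_sum (H : choiceType) T (r : seq T) (F : T -> ncpoly C H) :
  ncstar (\sum_(i <- r) F i) = \sum_(i <- r) ncstar (F i).
Proof. exact: (raddf_sum (mstar _)). Qed.

Lemma tensstarE a b : tensstar (tens a b) = tens (ncstar a) (ncstar b).
Proof.
rewrite (monalgE a) tens_suml ncstar_sum tensstar_sum tens_suml.
apply: eq_bigr => u _.
rewrite (monalgE b) tens_sumr ncstar_sum tensstar_sum tens_sumr.
apply: eq_bigr => v _.
by rewrite tensUU /ncstar /tensstar !mstarU tensUU rmorphM.
Qed.

Lemma tensstar_semilinear (c : C) f g :
  tensstar (c *: f + g) = c^* *: tensstar f + tensstar g.
Proof. exact: mstar_semilinear. Qed.

Lemma tensstarK : involutive tensstar.
Proof. by apply: mstarK => -[u v]; rewrite /= !pwrevK. Qed.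

Lemma tensstarM f g : tensstar (f * g) = tensstar g * tensstar f.
Proof. by apply: mstarM => u v; congr pair; exact: pwrevM. Qed.

Section Lift.
Variables (V : lmodType C) (beta : A -> B -> V).

Definition tens_lift : tensor -> V :=
  linext (fun uv : pword I * pword J => beta << uv.1 >> << uv.2 >>).

HB.instance Definition _ := GRing.Linear.on tens_lift.

Hypothesis beta_linl : forall b, linear (beta ^~ b).
Hypothesis beta_linr : forall a, linear (beta a).

Lemma tens_liftE a b : tens_lift (tens a b) = beta a b.
Proof.
pose fl (b : B) : {linear A -> V} :=
  HB.pack (beta ^~ b) (GRing.isLinear.Build C A V _ (beta ^~ b) (beta_linl b)).
pose fr (a : A) : {linear B -> V} :=
  HB.pack (beta a) (GRing.isLinear.Build C B V _ (beta a) (beta_linr a)).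
rewrite -[RHS]/(fl b a) -[LHS]/((tens_lift \o tensr b) a).
apply: malg_linear_ext => u /=.
rewrite -[RHS]/(fr << u >> b) -[LHS]/((tens_lift \o tens << u >>) b).
apply: malg_linear_ext => v /=.
by rewrite tensU /tens_lift linextU scale1r.
Qed.

Lemma tens_lift_unique (f : {linear tensor -> V}) :
  (forall a b, f (tens a b) = beta a b) -> f =1 tens_lift.
Proof.
move=> fE; apply: malg_linear_ext => -[u v].
by rewrite -[in LHS]tensU fE [RHS]linextU scale1r.
Qed.

End Lift.

Definition functens (f : A -> C) (g : B -> C) : tensor -> C :=
  tens_lift (fun a b => f a * g b : C^o).

Lemma functensE (f : {scalar A}) (g : {scalar B}) a b :
  functens f g (tens a b) = f a * g b.
Proof.
apply: (tens_liftE (beta := fun a b => f a * g b : C^o)) => [b' c x y|a' c x y].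
  by rewrite linearP /= mulrDl -mulrA.
by rewrite linearP /= mulrDr mulrCA.
Qed.

End Tensor.

(** The variable [Y] is ['X] in [{poly C}] and [ncX tt] in [ncpoly C unit].
    Blocks of length 0 contribute factors [phi 1], which are 1 for a state. *)

Section BoolExt.
Variables (C : numClosedFieldType) (phi : {poly C} -> C).
Local Notation Y := (ncX tt : ncpoly C unit).
Local Notation P := (ncP : ncpoly C unit).

Definition boolext : ncpoly C unit -> C :=
  linext (fun w : pword unit => \prod_(n <- runs w) phi 'X^n : C^o).

HB.instance Definition _ := GRing.Linear.copy boolext
  (linext (fun w : pword unit => \prod_(n <- runs w) phi 'X^n : C^o)).

Lemma boolextU c (w : pword unit) :
  boolext << c *g w >> = c * \prod_(n <- runs w) phi 'X^n.
Proof. exact: (linextU (V := C^o)). Qed.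

Lemma boolext_sum T (r : seq T) (F : T -> ncpoly C unit) :
  boolext (\sum_(i <- r) F i) = \sum_(i <- r) boolext (F i).
Proof. exact: raddf_sum. Qed.

Lemma boolext1 : boolext 1 = 1.
Proof. by rewrite (_ : 1 = << pw1 unit >>)// boolextU big_nil mul1r. Qed.

Fact pwY_reduced n : reduced (nseq n (Some tt)).
Proof. by case: n => //= n; elim: n. Qed.

Lemma ncYX n : Y ^+ n = << PWord (pwY_reduced n) >>.
Proof.
elim: n => [|n IH]; first by congr << _ >>; exact: val_inj.
rewrite exprS IH ncX.unlock malgM_def fgmulUU mulr1.
by congr << _ >>; exact: val_inj.
Qed.

Hypothesis phi1 : phi 1 = 1.

Lemma boolextP : boolext P = 1.
Proof. by rewrite ncP.unlock boolextU mul1r big_seq1 expr0. Qed.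

Lemma boolext_Y n : boolext (Y ^+ n) = phi 'X^n.
Proof.
rewrite ncYX boolextU mul1r /=.
case: n => [|n]; first by rewrite big_nil expr0.
rewrite (_ : runs _ = [:: n.+1]) ?big_seq1//.
by elim: n => //= n ->.
Qed.

Lemma boolext_PM f : boolext (P * f) = boolext f.
Proof.
rewrite (monalgE f) mulr_sumr !boolext_sum; apply: eq_bigr => w _.
rewrite ncP.unlock malgM_def fgmulUU !boolextU mul1r; congr (_ * _) => /=.
by case: (pword_val w) => [|[j|] s] //=; rewrite big_cons expr0 phi1 mul1r.
Qed.

Lemma boolext_YPM n f : boolext (Y ^+ n * (P * f)) = phi 'X^n * boolext f.
Proof.
rewrite (monalgE f) [P * _]mulr_sumr [_ ^+ _ * _]mulr_sumr !boolext_sum.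
rewrite [RHS]mulr_sumr; apply: eq_bigr => w _.
rewrite ncYX ncP.unlock !malgM_def !fgmulUU !boolextU !mul1r mulrCA; congr (_ * _).
have [s e ->] : exists2 s, pcons None w = None :: s &
    \prod_(k <- runs w) phi 'X^k = \prod_(k <- runs s) phi 'X^k.
  case: (pword_val w) => [|[j|] s]; [by exists [::]|by exists (Some j :: s)|].
  by exists s; rewrite //= big_cons expr0 phi1 mul1r.
transitivity (\prod_(k <- n :: runs s) phi 'X^k); last by rewrite big_cons.
congr (\prod_(k <- _) _).
change (runs (wmul (nseq n (Some tt)) (pcons None w)) = n :: runs s).
by rewrite e; elim: n => //= n ->.
Qed.

Lemma boolextE (a b : bool) (n : nat) (ns : seq nat) :
  boolext (P ^+ a * Y ^+ n * (\prod_(m <- ns) (P * Y ^+ m)) * P ^+ b) =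
  phi 'X^n * \prod_(m <- ns) phi 'X^m.
Proof.
have PXM (c : bool) f : boolext (P ^+ c * f) = boolext f.
  by case: c; rewrite ?expr1 ?expr0; [exact: boolext_PM|rewrite [_ * f]mul1r].
have assoc (f g h k : ncpoly C unit) : f * g * h * k = f * (g * (h * k)).
  by rewrite -2!mulrA.
rewrite assoc PXM; elim: ns n => [|m ns IH] n.
  rewrite !big_nil (mul1r (P ^+ b)) (mulr1 (phi _)); case: b.
    change (boolext (Y ^+ n * P) = phi 'X^n).
    by have := boolext_YPM n 1; rewrite (mulr1 P) boolext1 (mulr1 (phi _)).
  change (boolext (Y ^+ n * 1) = phi 'X^n).
  by rewrite (mulr1 (Y ^+ n)) boolext_Y.
rewrite !big_cons -(IH m) assoc.
exact: boolext_YPM.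
Qed.

End BoolExt.

(** [Gz] and [Gw] are the generators [z], [w] of the free semigroup [seq gen];
    in [ncpoly C gen], [ncX Gz] is [X] and [ncX Gw] is [X']. *)
Variant gen := Gz | Gw.

Definition gen_bool (g : gen) := if g is Gz then true else false.
Definition bool_gen b := if b then Gz else Gw.
Fact gen_boolK : cancel gen_bool bool_gen. Proof. by case. Qed.
HB.instance Definition _ := Choice.copy gen (can_type gen_boolK).

Section Filtered.
Variable C : numClosedFieldType.
Local Notation B := (ncpoly C gen).
Local Notation BB := (tensor C gen gen).
Local Notation X := (ncX : gen -> B).
Local Notation P := (ncP : B).

Definition Delta : B -> BB :=
  nceval (fun g => match g with
                   | Gz => tens (X Gz) 1 + tens 1 (X Gz)
                   | Gw => tens (X Gw) P + tens P (X Gw)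
                   end) (tens P P).

Definition eta : B -> ncpoly C unit := nceval (fun=> ncX tt) ncP.

HB.instance Definition _ := GRing.Linear.on Delta.
HB.instance Definition _ := GRing.Linear.on eta.
HB.instance Definition _ := GRing.isMonoidMorphism.Build B BB Delta
  (nceval_is_multiplicative _ (etrans (tensM _ _ _ _)
     (f_equal2 (@tens C gen gen) (ncPP C gen) (ncPP C gen)))).
HB.instance Definition _ := GRing.isMonoidMorphism.Build B (ncpoly C unit) eta
  (nceval_is_multiplicative _ (ncPP C unit)).

Lemma Delta_z : Delta (X Gz) = tens (X Gz) 1 + tens 1 (X Gz).
Proof. exact: ncevalX. Qed.

Lemma Delta_w : Delta (X Gw) = tens (X Gw) P + tens P (X Gw).
Proof. exact: ncevalX. Qed.

Lemma Delta_P : Delta P = tens P P.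
Proof. exact: ncevalP. Qed.

Lemma eta_X g : eta (X g) = ncX tt.
Proof. exact: ncevalX. Qed.

Lemma eta_P : eta P = ncP.
Proof. exact: ncevalP. Qed.

Lemma Delta_star f : Delta (ncstar f) = tensstar (Delta f).
Proof.
move: f; apply: ncpoly_ind.
- by rewrite ncstar1 rmorph1 -tens11 tensstarE ncstar1.
- by rewrite ncstarP Delta_P tensstarE ncstarP.
- move=> g; rewrite ncstarX.
  have addE (s t : BB) : tensstar (s + t) = tensstar s + tensstar t.
    exact: (raddfD (mstar _)).
  case: g; [rewrite Delta_z|rewrite Delta_w]; rewrite addE !tensstarE.
    by rewrite ncstarX ncstar1.
  by rewrite ncstarX ncstarP.
- move=> c f g ef eg.
  by rewrite ncstarP_lin linearP linearP /= tensstar_semilinear -ef -eg.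
- by move=> f g ef eg; rewrite ncstarM rmorphM rmorphM tensstarM -ef -eg.
Qed.

Lemma eta_star f : eta (ncstar f) = ncstar (eta f).
Proof.
move: f; apply: ncpoly_ind.
- by rewrite ncstar1 rmorph1 ncstar1.
- by rewrite ncstarP eta_P ncstarP.
- by move=> g; rewrite ncstarX eta_X ncstarX.
- move=> c f g ef eg.
  by rewrite ncstarP_lin linearP linearP /= ncstarP_lin -ef -eg.
- by move=> f g ef eg; rewrite ncstarM rmorphM rmorphM ncstarM -ef -eg.
Qed.

Definition fconv (phi psi : B -> C) : B -> C := functens phi psi \o Delta.

Definition wordX (s : seq gen) : B := \prod_(g <- s) X g.

End Filtered.

Section Laws.
Variable R : realType.
Local Notation law := (probability (measurableTypeR R) R).
Implicit Types (sigma mu nu rho : law).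

Definition finite_moments sigma :=
  forall n, sigma.-integrable setT (fun x : R => (x ^+ n)%:E).

Definition moment sigma n : R := \int[sigma]_x (x ^+ n).

Definition momentfun sigma (q : {poly R[i]}) : R[i] :=
  \sum_(k < size q) q`_k * (moment sigma k)%:C.

Lemma momentfunX sigma n : momentfun sigma 'X^n = (moment sigma n)%:C.
Proof.
rewrite /momentfun size_polyXn big_ord_recr /= coefXn eqxx mul1r big1 ?add0r//.
by move=> k _; rewrite coefXn ltn_eqF ?ltn_ord// mul0r.
Qed.

Lemma momentfun_linear sigma : scalar (momentfun sigma).
Proof.
have ext (q : {poly R[i]}) m : (size q <= m)%N ->
    momentfun sigma q = \sum_(k < m) q`_k * (moment sigma k)%:C.
  move=> qm; rewrite /momentfun.
  rewrite (big_ord_widen _ (fun k => q`_k * (moment sigma k)%:C) qm).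
  rewrite big_mkcond/=; apply: eq_bigr => k _.
  by case: ltnP => // ?; rewrite nth_default// mul0r.
move=> c p q; pose m := maxn (size p) (size q).
rewrite (ext (c *: p + q) m) ?(ext p m) ?(ext q m) ?leq_maxl ?leq_maxr//.
  rewrite mulr_sumr -big_split/=; apply: eq_bigr => k _.
  by rewrite coefD coefZ mulrDl mulrA.
rewrite (leq_trans (size_polyD _ _))// geq_max leq_maxr andbT.
by rewrite (leq_trans (size_scale_leq _ _))// leq_maxl.
Qed.

Lemma momentfun1 sigma : momentfun sigma 1 = 1.
Proof.
rewrite -[1](expr0 'X) momentfunX /moment.
under eq_Rintegral do rewrite expr0.
by rewrite Rintegral_cst// mul1r [X in fine X](probability_setT sigma).
Qed.

Definition hat sigma : ncpoly R[i] gen -> R[i] :=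
  boolext (momentfun sigma) \o @eta R[i].

Lemma hat_linear sigma : scalar (hat sigma).
Proof.
move=> c f g; rewrite /hat /= linearP.
exact: (linearP (boolext (momentfun sigma))).
Qed.

Definition addp (x : measurableTypeR R * measurableTypeR R) :
  measurableTypeR R := x.1 + x.2.

Fact measurable_addp : measurable_fun setT addp.
Proof. by apply: measurable_funD. Qed.

HB.instance Definition _ := isMeasurableFun.Build _ _
  (measurableTypeR R * measurableTypeR R)%type (measurableTypeR R)
  addp measurable_addp.

Definition classical_convolution mu nu : law := distribution (mu \x nu)%E addp.

Definition cintegral sigma (f : R -> R[i]) : R[i] :=
  (\int[sigma]_x complex.Re (f x)) +i* (\int[sigma]_x complex.Im (f x)).

Definition cauchyG sigma (zeta : R[i]) : R[i] :=
  cintegral sigma (fun x => (zeta - x%:C)^-1).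

Definition boolK sigma (zeta : R[i]) : R[i] := zeta - (cauchyG sigma zeta)^-1.

(** The functions [boolK] are compared on the upper half-plane; on the lower one
    they take the complex conjugate values. *)
Definition boolean_convolution mu nu rho :=
  forall zeta : R[i], 0 < complex.Im zeta ->
    boolK rho zeta = boolK mu zeta + boolK nu zeta.

End Laws.

(* Main.v *)
(** On powers of [X] the coproduct is [X (x) 1 + 1 (x) X], a sum of commuting
    elements, and the binomial formula gives the moments of the sum of two
    independent variables.

    On powers of [X'] expand [(a + b)^n] with [a = X' (x) P], [b = P (x) X'].
    Since [P] separates runs, a word in [a], [b] is sent to the product of the
    moments of its maximal runs. Let [U], [V] be the generating series of the
    words not starting with [a], [b]. Splitting off the first run, the series
    [M] of all words satisfies [M = M_mu U = M_nu V = U + V - 1], hence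
    [1/M = 1/M_mu + 1/M_nu - 1], which is the relation between [zeta G(zeta)]
    for [mu], [nu] and their boolean convolution.

    As [rho] is only known through its Cauchy transform, one still has to
    recover its moments. Along [zeta = i/t], [t -> 0+], the functions
    [zeta G(zeta)] of [mu] and [nu] have asymptotic expansions in [1/zeta] to
    all orders, so [zeta G_rho(zeta)] has the expansion given by [M]. As in the
    Hamburger-Nevanlinna theorem, the moments of [rho] are then found two at a
    time: the expansion gives the limit of the integrals of
    [x^(2k+2) / (1 + t^2 x^2)], and monotone convergence applies. *)
Require Import Defs.
From HB Require Import structures.
From mathcomp Require Import all_boot all_order all_algebra.
From mathcomp Require Import finmap monalg complex ring lra.
From mathcomp Require Import all_classical all_reals all_analysis.
From mathcomp Require Import measurable_realfun.

Import Order.TTheory GRing.Theory Num.Theory.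
Import numFieldNormedType.Exports.

Local Open Scope classical_set_scope.
Local Open Scope ring_scope.
Local Open Scope complex_scope.

(** * Powers of a sum of two elements, expanded by initial runs *)

Section FirstSwitch.
Variables (C : comNzRingType) (A : algType C) (T : {scalar A}).
Variables (a b : A) (s : nat -> C).
Hypothesis Tab : forall k f, T (a ^+ k * (b * f)) = s k * T (b * f).
Hypothesis Ta : forall k, T (a ^+ k) = s k.

(* The total weight of the words of length [j] not starting with [a]. *)
Definition switch_weight j : C := if j is i.+1 then T (b * (a + b) ^+ i) else 1.

(** Expand the leftmost factor of [(a + b) ^+ n.+1]: [a] lengthens the initial run, hence the
    induction for all [k] at once; [b] ends it, and [Tab] splits off [s k]. The index [j] is the
    length left after the run. *)
Lemma expr_first_switch k n :
  T (a ^+ k * (a + b) ^+ n) =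
  \sum_(j < n.+1) s (k + (n - j))%N * switch_weight j.
Proof.
elim: n k => [|n IH] k; first by rewrite big_ord1 mulr1 Ta addn0 mulr1.
rewrite exprS mulrDl mulrDr linearD /= Tab mulrA -exprSr IH.
rewrite [RHS]big_ord_recr /= subnn addn0; congr (_ + _).
by apply: eq_bigr => j _; rewrite subSn ?addSnnS// -ltnS.
Qed.

End FirstSwitch.

(** [u n] and [v n] weigh the words of length [n] not starting with [a], resp. [b]. A nonempty word
    is counted in exactly one of them, the empty word in both, whence the correction at [n = 0]. *)
Lemma expr_addr_switch (C : comNzRingType) (A : algType C) (T : {scalar A})
    (a b : A) (s t : nat -> C) :
  (forall k f, T (a ^+ k * (b * f)) = s k * T (b * f)) ->
  (forall k, T (a ^+ k) = s k) ->
  (forall k f, T (b ^+ k * (a * f)) = t k * T (a * f)) ->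
  (forall k, T (b ^+ k) = t k) ->
  T 1 = 1 ->
  exists u v : nat -> C, [/\ u 0%N = 1, v 0%N = 1 & forall n,
    [/\ T ((a + b) ^+ n) = u n + v n - (n == 0%N)%:R,
    T ((a + b) ^+ n) = \sum_(j < n.+1) s (n - j)%N * u j &
    T ((a + b) ^+ n) = \sum_(j < n.+1) t (n - j)%N * v j]].
Proof.
move=> Tab Ta Tba Tb T1.
exists (switch_weight C A T a b), (switch_weight C A T b a).
split=> // n; split.
- case: n => [|n]; first by rewrite expr0 T1 addrK.
  by rewrite subr0 exprS mulrDl linearD /= addrC (addrC a b).
- by rewrite -[_ ^+ n]mul1r -(expr0 a) (expr_first_switch _ _ _ _ _ _ Tab Ta).
- rewrite -[_ ^+ n]mul1r -(expr0 b) (addrC a b).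
  by rewrite (expr_first_switch _ _ _ _ _ _ Tba Tb).
Qed.

(** * The filtered convolution on powers of [X] and [X'] *)

Section FilteredConvolution.
Variables (R : realType) (mu nu : probability (measurableTypeR R) R).
Local Notation C := R[i].
Local Notation B := (ncpoly C gen).
Local Notation X := (ncX : gen -> B).
Local Notation P := (ncP : B).

Lemma hatX sigma g k : hat sigma (X g ^+ k) = (@moment R sigma k)%:C.
Proof.
rewrite /hat /= rmorphXn /= eta_X boolext_Y -?momentfunX//.
exact: momentfun1.
Qed.

Lemma hat_P_mul sigma f : @hat R sigma (P * f) = hat sigma f.
Proof. by rewrite /hat /= rmorphM /= eta_P boolext_PM//; exact: momentfun1. Qed.

Lemma hat_expP_mul sigma k f : @hat R sigma (P ^+ k * f) = hat sigma f.
Proof.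
elim: k => [|k IH]; first by rewrite expr0 [_ * f]mul1r.
by rewrite exprS -[_ * f]mulrA hat_P_mul.
Qed.

Lemma hat_expX_mul_P sigma g k f :
  @hat R sigma (X g ^+ k * (P * f)) = (moment sigma k)%:C * hat sigma f.
Proof.
rewrite /hat /= rmorphM rmorphXn rmorphM /= eta_X eta_P.
rewrite boolext_YPM ?momentfunX//.
exact: momentfun1.
Qed.

HB.instance Definition _ sigma :=
  GRing.isLinear.Build C B C *%R (@hat R sigma) (hat_linear sigma).

Local Notation T := (functens (hat mu) (hat nu)).

HB.instance Definition _ := GRing.Linear.on T.

Lemma functens_hat_tens a b : T (tens a b) = hat mu a * hat nu b.
Proof. exact: functensE. Qed.

(** The basis vectors of the tensor product are elementary tensors, so by linearity such an identity
    need only be checked there, where [T] factors. *)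
Lemma functens_hat_ext (g h : tensor C gen gen) (c : C) :
  (forall p q, T (g * tens p q) = c * T (h * tens p q)) ->
  forall f, T (g * f) = c * T (h * f).
Proof.
move=> gh; pose TT := tensor C gen gen.
have lin (k : TT) (d : C) : scalar (fun f : TT => d * T (k * f)).
  move=> e x y; rewrite mulrDr -scalerAr linearP /= mulrDr.
  by rewrite mulrCA.
pose L k d : {linear TT -> C^o} := HB.pack (fun f : TT => d * T (k * f))
  (GRing.isLinear.Build C TT C^o *:%R (fun f : TT => d * T (k * f)) (lin k d)).
move=> f; rewrite -[LHS]mul1r.
have := @malg_linear_ext C _ C^o (L g 1) (L h c) _ f; apply => -[u v].
have e : << (u, v) >> = tens << u >> << v >> :> TT by rewrite tensU.
change (1 * T (g * << (u, v) >>) = c * T (h * << (u, v) >>)).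
by rewrite e mul1r; exact: gh.
Qed.

Lemma tensXn (a b : B) k : tens a b ^+ k = tens (a ^+ k) (b ^+ k).
Proof.
by elim: k => [|k IH]; [rewrite tens11|rewrite !exprS IH tensM].
Qed.

Lemma fconv_nseq g n :
  fconv (hat mu) (hat nu) (wordX C (nseq n g)) = T (Delta (X g) ^+ n).
Proof. by rewrite /fconv /wordX /= big_nseq -Monoid.iteropE rmorphXn. Qed.

Lemma fconv_z n : fconv (hat mu) (hat nu) (wordX C (nseq n Gz)) =
  (\sum_(i < n.+1) (moment mu (n - i) * moment nu i) *+ 'C(n, i))%:C.
Proof.
rewrite fconv_nseq Delta_z exprDn_comm; last first.
  by rewrite /GRing.comm !tensM !mulr1 !mul1r.
rewrite !raddf_sum; apply: eq_bigr => i _.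
rewrite !raddfMn /=; congr (_ *+ _).
by rewrite !tensXn !expr1n tensM mulr1 mul1r functens_hat_tens !hatX rmorphM.
Qed.

Local Notation a := (tens (X Gw) P).
Local Notation b := (tens P (X Gw)).

Lemma functens_hat_tensM (c d : C) x x' y y' : hat mu x = c * hat mu x' ->
  hat nu y = d * hat nu y' -> T (tens x y) = (c * d) * T (tens x' y').
Proof.
move=> ex ey; rewrite [LHS]functens_hat_tens [in RHS]functens_hat_tens ex ey.
by rewrite mulrACA.
Qed.

(** [P] reappears on the right because it belongs to the next letter of the word, whose weight must
    stay intact. *)
Lemma hat_expX_P_mul sigma g k f : @hat R sigma (X g ^+ k * P * f) =
  (moment sigma k)%:C * hat sigma (P * f).
Proof.
rewrite -[X in hat _ X = _](mulrA (X g ^+ k) P f) [in RHS]hat_P_mul.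
exact: hat_expX_mul_P.
Qed.

Lemma hat_expP_X_mul sigma g k f :
  @hat R sigma (P ^+ k * X g * f) = 1 * hat sigma (X g * f).
Proof.
rewrite -[X in hat _ X = _](mulrA (P ^+ k) (X g) f) mul1r.
exact: hat_expP_mul.
Qed.

(** In the first leg, [a ^+ k * b] is [X Gw ^+ k * P], where [P] closes the run and releases the
    [k]-th moment; in the second it is [P ^+ k * X Gw], whose leading power of [P] is invisible to
    [hat nu]. *)
Lemma functens_hat_runl k f :
  T (a ^+ k * (b * f)) = (moment mu k)%:C * T (b * f).
Proof.
rewrite mulrA; move: f; apply: functens_hat_ext => p q.
rewrite tensXn 3!tensM.
apply: etrans (functens_hat_tensM _ _ _ _ _ _
  (hat_expX_P_mul _ _ _ _) (hat_expP_X_mul _ _ _ _)) _.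
by rewrite mulr1.
Qed.

Lemma functens_hat_runr k f :
  T (b ^+ k * (a * f)) = (moment nu k)%:C * T (a * f).
Proof.
rewrite mulrA; move: f; apply: functens_hat_ext => p q.
rewrite tensXn 3!tensM.
apply: etrans (functens_hat_tensM _ _ _ _ _ _
  (hat_expP_X_mul _ _ _ _) (hat_expX_P_mul _ _ _ _)) _.
by rewrite mul1r.
Qed.

Lemma hat_expP sigma k : @hat R sigma (P ^+ k) = 1.
Proof.
rewrite -[P ^+ k]mulr1 hat_expP_mul -[1](expr0 (X Gw)) hatX -momentfunX.
by rewrite expr0 momentfun1.
Qed.


Local Notation mixed n := (fconv (hat mu) (hat nu) (wordX C (nseq n Gw))).


Lemma fconv_w : exists u v : nat -> C, [/\ u 0%N = 1, v 0%N = 1 & forall n,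
  [/\ mixed n = u n + v n - (n == 0%N)%:R,
    mixed n = \sum_(j < n.+1) (moment mu (n - j))%:C * u j &
    mixed n = \sum_(j < n.+1) (moment nu (n - j))%:C * v j]].
Proof.
have Ta k : T (a ^+ k) = (moment mu k)%:C.
  by rewrite tensXn functens_hat_tens hatX hat_expP mulr1.
have Tb k : T (b ^+ k) = (moment nu k)%:C.
  by rewrite tensXn functens_hat_tens hatX hat_expP mul1r.
have T1 : T 1 = 1 by rewrite -(expr0 a) Ta -momentfunX expr0 momentfun1.
have [u [v [u0 v0 uvE]]] := expr_addr_switch _ _ _ _ _
  (fun k => (moment mu k)%:C) (fun k => (moment nu k)%:C)
  functens_hat_runl Ta functens_hat_runr Tb T1.
exists u, v; split=> // n.
have -> : mixed n = T ((a + b) ^+ n) by rewrite fconv_nseq Delta_w.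
exact: uvE.
Qed.

Lemma moment0 (sigma : probability (measurableTypeR R) R) : moment sigma 0 = 1.
Proof. by apply/(@complexI R); rewrite -momentfunX expr0 momentfun1. Qed.

Lemma sumC_real n (s : nat -> R) (u : nat -> C) :
  (forall j, (j < n)%N -> u j = (complex.Re (u j))%:C) ->
  \sum_(j < n) (s j)%:C * u j =
  (\sum_(j < n) s j * complex.Re (u j))%:C.
Proof.
move=> uR; rewrite raddf_sum; apply: eq_bigr => j _ /=.
by rewrite uR// rmorphM.
Qed.

(** The expansions to come have real coefficients. Those of [fconv_w] are real by a joint recursion:
    each one is a combination, with real moments, of earlier coefficients of the other series. *)
Lemma fconv_w_real : exists u v : nat -> R, [/\ u 0%N = 1,
  forall n, mixed n = (u n + v n - (n == 0%N)%:R)%:C,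
  forall n, u n + v n - (n == 0%N)%:R =
    \sum_(j < n.+1) moment mu (n - j) * u j &
  forall n, u n + v n - (n == 0%N)%:R =
    \sum_(j < n.+1) moment nu (n - j) * v j].
Proof.
have [u [v [u0 v0 uvE]]] := fconv_w.
have ReK (x : R) (y : C) : y = x%:C -> y = (complex.Re y)%:C by move=> ->.
(* The last term of the full sum is [u n.+1], as the zeroth moment is 1; it cancels. *)
have vE n : v n.+1 = \sum_(j < n.+1) (moment mu (n.+1 - j))%:C * u j.
  have [-> + _] := uvE n.+1; rewrite subr0 big_ord_recr /= subnn moment0 mul1r.
  by move=> e; apply: (addrI (u n.+1)); rewrite e addrC.
have uE n : u n.+1 = \sum_(j < n.+1) (moment nu (n.+1 - j))%:C * v j.
  have [-> _] := uvE n.+1; rewrite subr0 big_ord_recr /= subnn moment0 mul1r.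
  by move/addIr.
have uvR n k : (k < n)%N -> u k = (complex.Re (u k))%:C /\
    v k = (complex.Re (v k))%:C.
  elim: n k => // n IH [|k]; first by rewrite u0 v0.
  rewrite ltnS => kn; split.
    rewrite uE.
    apply: (ReK _ _ (sumC_real _ (fun j => moment nu (k.+1 - j)) v _)) => j jk.
    exact: (IH _ (leq_trans jk kn)).2.
  rewrite vE.
  apply: (ReK _ _ (sumC_real _ (fun j => moment mu (k.+1 - j)) u _)) => j jk.
  exact: (IH _ (leq_trans jk kn)).1.
have uR k : u k = (complex.Re (u k))%:C by case: (uvR k.+1 k).
have vR k : v k = (complex.Re (v k))%:C by case: (uvR k.+1 k).
have mR n : u n + v n - (n == 0%N)%:R =
   (complex.Re (u n) + complex.Re (v n) - (n == 0%N)%:R)%:C.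
  by rewrite rmorphB rmorphD /= -uR -vR rmorph_nat.
exists (fun n => complex.Re (u n)), (fun n => complex.Re (v n)); split.
- by rewrite u0.
- by move=> n; have [-> _ _] := uvE n.
- move=> n; apply/(@complexI R); rewrite -mR; have [<- -> _] := uvE n.
  by apply: (sumC_real _ (fun j => moment mu (n - j))) => j _.
- move=> n; apply/(@complexI R); rewrite -mR; have [<- _ ->] := uvE n.
  by apply: (sumC_real _ (fun j => moment nu (n - j))) => j _.
Qed.

End FilteredConvolution.

(** * Product measures and the moments of the classical convolution *)

Section ProductMoments.
Context d1 d2 (T1 : measurableType d1) (T2 : measurableType d2) (R : realType).
Variables (mu : {finite_measure set T1 -> \bar R}).
Variables (nu : {finite_measure set T2 -> \bar R}).
Variables (f : T1 -> R) (g : T2 -> R).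
Hypothesis fi : mu.-integrable setT (EFin \o f).
Hypothesis gi : nu.-integrable setT (EFin \o g).

Let mfg : measurable_fun setT (fun z : T1 * T2 => f z.1 * g z.2).
Proof.
have /measurable_EFinP mf := measurable_int _ fi.
have /measurable_EFinP mg := measurable_int _ gi.
apply: measurable_funM; apply: measurableT_comp => //.
Qed.

(** Tonelli: the iterated integral of the absolute value is a product of two finite integrals. *)
Lemma integrable_prod_fun :
  (mu \x nu)%E.-integrable setT (fun z => (f z.1 * g z.2)%:E).
Proof.
apply/integrable12ltyP; first exact/measurable_EFinP.
have Ig := integrable_fin_num measurableT (integrable_abse gi).
rewrite (eq_integral (fun x =>
  (fine (\int[nu]_y `|(g y)%:E|))%:E * `|(f x)%:E|)%E).
  rewrite integralZl//; last exact: integrable_abse.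
  have If := integrable_fin_num measurableT (integrable_abse fi).
  by rewrite -(fineK If) -EFinM ltry.
move=> x _; rewrite fineK// muleC -integralZl//; last exact: integrable_abse.
by apply: eq_integral => y _; rewrite abse_EFin normrM EFinM.
Qed.

Lemma Rintegral_prod_fun :
  \int[(mu \x nu)%E]_z (f z.1 * g z.2) = (\int[mu]_x f x) * (\int[nu]_y g y).
Proof.
have Ig := integrable_fin_num measurableT gi.
have If := integrable_fin_num measurableT fi.
rewrite /Rintegral -(integral12_prod_meas1 integrable_prod_fun) /fubini_F/=.
rewrite (eq_integral (fun x => (fine (\int[nu]_y (g y)%:E))%:E * (f x)%:E)%E).
  by rewrite integralZl// -(fineK If) -EFinM/= mulrC.
move=> x _; rewrite fineK// muleC -integralZl//.
Qed.
End ProductMoments.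

Section RintegralSum.
Context d (T : measurableType d) (R : realType).
Variables (mu : {measure set T -> \bar R}) (f : nat -> T -> R).
Hypothesis fi : forall i, mu.-integrable setT (EFin \o f i).

Lemma integrable_sumR n :
  mu.-integrable setT (EFin \o (fun x => \sum_(i < n) f i x)).
Proof.
have := @integrable_sum _ _ _ mu setT measurableT _ (index_enum 'I_n) predT
  (fun i : 'I_n => EFin \o f i) (fun i _ => fi i).
by apply: eq_integrable => // x _ /=; rewrite sumEFin.
Qed.

Lemma Rintegral_sum n :
  \int[mu]_x (\sum_(i < n) f i x) = \sum_(i < n) \int[mu]_x f i x.
Proof.
elim: n => [|n IH].
  under eq_Rintegral do rewrite big_ord0.
  by rewrite Rintegral_cst// mul0r big_ord0.
under eq_Rintegral do rewrite big_ord_recr /=.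
by rewrite RintegralD ?IH ?big_ord_recr//; exact: integrable_sumR.
Qed.

End RintegralSum.

Section ConvolutionMoments.
Variables (R : realType) (mu nu : probability (measurableTypeR R) R).
Hypotheses (mu_moments : finite_moments mu) (nu_moments : finite_moments nu).

Let term n i (z : R * R) : R := 'C(n, i)%:R * (z.1 ^+ (n - i) * z.2 ^+ i).

Let binomE n : (fun z : R * R => (z.1 + z.2) ^+ n) =
  fun z => \sum_(i < n.+1) term n i z.
Proof.
by apply/funext => z; rewrite exprDn; apply: eq_bigr => i _; rewrite -mulr_natl.
Qed.

Let integrable_prodX m k :
  (mu \x nu)%E.-integrable setT (fun z => (z.1 ^+ m * z.2 ^+ k)%:E).
Proof.
exact: (integrable_prod_fun _ _ _ _ _ _ _ _ _ (mu_moments m) (nu_moments k)).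
Qed.

Let integrable_term n i : (mu \x nu)%E.-integrable setT (EFin \o term n i).
Proof.
rewrite /term /comp; under eq_fun do rewrite EFinM.
exact: integrableZl (integrable_prodX _ _).
Qed.

Let integrable_addX n : (mu \x nu)%E.-integrable setT
  (EFin \o (fun z : R * R => (z.1 + z.2) ^+ n)).
Proof. by rewrite binomE; apply: integrable_sumR; exact: integrable_term. Qed.

Lemma finite_moments_convolution : finite_moments (classical_convolution mu nu).
Proof.
move=> n; apply/integrable_pushforward => //; last exact: (integrable_addX n).
by apply/measurable_EFinP; exact: exprn_measurable.
Qed.

Lemma moment_convolution n : moment (classical_convolution mu nu) n =
  \sum_(i < n.+1) (moment mu (n - i) * moment nu i) *+ 'C(n, i).
Proof.
transitivity (\int[(mu \x nu)%E]_z ((z.1 + z.2) ^+ n)).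
  rewrite /moment /Rintegral integral_pushforward//=;
    last exact: (integrable_addX n).
  by apply/measurable_EFinP; exact: exprn_measurable.
transitivity (\int[(mu \x nu)%E]_z (\sum_(i < n.+1) term n i z)).
  by congr (Rintegral _ _ _); exact: binomE.
rewrite Rintegral_sum//; apply: eq_bigr => i _.
rewrite RintegralZl//; last exact: (integrable_prodX (n - i) i).
rewrite mulr_natl; congr (_ *+ _).
exact: (Rintegral_prod_fun _ _ _ _ _ mu nu _ _ (mu_moments _) (nu_moments _)).
Qed.
End ConvolutionMoments.

(** * Damped powers and bounds uniform in [t] *)

Section Damped.
Variables (R : realType) (sigma : probability (measurableTypeR R) R).
Local Notation integrableX k :=
  (sigma.-integrable setT (fun x : R => (x ^+ k)%:E)).

(** The real part of [x^k / (1 + i t x)], whose imaginary part is [- t * damped k.+1 t x]. *)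
Definition damped k (t x : R) : R := x ^+ k / (1 + (t * x) ^+ 2).

Definition damped_moment k t : R := \int[sigma]_x (damped k t x).

Definition abs_moment k : R := \int[sigma]_x `|x ^+ k|.

Lemma damped_den_gt0 (t x : R) : 0 < 1 + (t * x) ^+ 2.
Proof. by rewrite ltr_pwDl ?ltr01// sqr_ge0. Qed.

Lemma damped_measurable k t : measurable_fun setT (damped k t).
Proof.
apply: measurable_funM; first exact: exprn_measurable.
apply: continuous_measurable_fun => x.
apply: cvgV; first by rewrite gt_eqF// damped_den_gt0.
have cx : t * y @[y --> x] --> t * x by apply: cvgMr; exact: cvg_id.
by apply: cvgD; [exact: cvg_cst|rewrite expr2; apply: cvgM].
Qed.

Lemma damped_le k t x : `|damped k t x| <= `|x ^+ k|.
Proof.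
rewrite normrM (gtr0_norm (_ : 0 < (_)^-1)) ?invr_gt0 ?damped_den_gt0//.
rewrite ler_pdivrMr ?damped_den_gt0// ler_peMr// lerDl sqr_ge0//.
Qed.

(** As [|t x| <= 1 + (t x)^2], one factor [t] pays for one extra power of [x]. *)
Lemma damped_leS k t x : 0 < t -> t * `|damped k.+1 t x| <= `|x ^+ k|.
Proof.
move=> t0; have d0 := damped_den_gt0 t x.
rewrite /damped normrM normfV (gtr0_norm d0) mulrA ler_pdivrMr//.
rewrite exprSr normrM mulrCA ler_wpM2l// -{1}(gtr0_norm t0) -normrM.
rewrite -(real_normK (num_real (t * x))).
have := sqr_ge0 (`|t * x| - 1); have := sqr_ge0 `|t * x|.
by nra.
Qed.

(** Write [(t x)^2] as [(1 + (t x)^2) - 1]. This makes [damped k.+2] integrable before the moment of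
    order [k.+2] is known to exist. *)
Lemma damped_SS k t x : t ^+ 2 * damped k.+2 t x = x ^+ k - damped k t x.
Proof.
have h : 1 + (t * x) ^+ 2 != 0 by rewrite gt_eqF// damped_den_gt0.
have e : x ^+ k.+2 = x ^+ 2 * x ^+ k by rewrite -exprD.
rewrite /damped e; move: (x ^+ k) => y; apply: (mulIf h).
by rewrite mulrBl mulrA !divfK//; ring.
Qed.

Lemma integrable_damped k t : integrableX k ->
  sigma.-integrable setT (EFin \o damped k t).
Proof.
have md := damped_measurable k t.
apply: le_integrable => //; first exact/measurable_EFinP.
by move=> x _; rewrite lee_fin damped_le.
Qed.

Lemma integrable_dampedS k t : 0 < t -> integrableX k ->
  sigma.-integrable setT (EFin \o damped k.+1 t).
Proof.
move=> t0 ik; have md := damped_measurable k.+1 t.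
have := integrableZl measurableT t^-1 ik; apply: le_integrable => //.
  exact/measurable_EFinP.
move=> x _; rewrite -EFinM /= lee_fin (normrM t^-1).
rewrite (gtr0_norm (_ : 0 < t^-1)) ?invr_gt0//.
by rewrite [leRHS]mulrC ler_pdivlMr// [leLHS]mulrC damped_leS.
Qed.

Lemma integrable_dampedSS k t : 0 < t -> integrableX k ->
  sigma.-integrable setT (EFin \o damped k.+2 t).
Proof.
move=> t0 ik; have id := integrable_damped k t ik.
have := integrableZl measurableT (t ^- 2) (integrableB measurableT ik id).
apply: eq_integrable => // x _ /=.
rewrite -EFinB -damped_SS -EFinM mulrA mulVf ?mul1r//.
by rewrite expf_eq0 /= gt_eqF.
Qed.

Lemma damped_momentE k t : 0 < t -> integrableX k ->
  moment sigma k = damped_moment k t + t ^+ 2 * damped_moment k.+2 t.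
Proof.
move=> t0 ik.
rewrite /damped_moment -RintegralZl//; last exact: integrable_dampedSS.
under [in X in _ + X]eq_Rintegral do rewrite damped_SS.
rewrite RintegralB//; last exact: integrable_damped.
by rewrite addrC subrK.
Qed.

Lemma abs_moment_ge0 k : 0 <= abs_moment k.
Proof. exact: Rintegral_ge0. Qed.

Lemma damped_moment_le k t : integrableX k ->
  `|damped_moment k t| <= abs_moment k.
Proof.
move=> ik; have id := integrable_damped k t ik.
apply: (@le_trans _ _ (\int[sigma]_x `|damped k t x|)).
  exact: le_normr_Rintegral.
apply: le_Rintegral => //; last by move=> x _; exact: damped_le.
  exact: integrable_norm id.
exact: integrable_norm ik.
Qed.

Lemma damped_momentS_le k t : 0 < t -> integrableX k ->
  t * `|damped_moment k.+1 t| <= abs_moment k.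
Proof.
move=> t0 ik; have id := integrable_dampedS k t t0 ik.
apply: (@le_trans _ _ (t * \int[sigma]_x `|damped k.+1 t x|)).
  by rewrite ler_pM2l//; exact: le_normr_Rintegral.
rewrite -RintegralZl//; last exact: integrable_norm id.
apply: le_Rintegral => //; last by move=> x _; exact: damped_leS.
  have := integrableZl measurableT t (integrable_norm id).
  by apply: eq_integrable.
exact: integrable_norm ik.
Qed.

End Damped.

(** * Monotone limits, and the Cauchy transform on the imaginary axis *)

Section Limit.
Variables (R : realType) (sigma : probability (measurableTypeR R) R).
Local Notation integrableX k :=
  (sigma.-integrable setT (fun x : R => (x ^+ k)%:E)).

Lemma damped_cvg k (x : R) : damped R k (harmonic n) x @[n --> \oo] --> x ^+ k.
Proof.
rewrite -[x ^+ k]mulr1 /damped; apply: cvgM; first exact: cvg_cst.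
rewrite -[X in _ --> X](@invr1 R); apply: cvgV; first exact: oner_neq0.
rewrite -[X in _ --> X](addr0 (1 : R)); apply: cvgD; first exact: cvg_cst.
have h : harmonic n * x @[n --> \oo] --> 0 * x.
  by apply: cvgMl; exact: (@cvg_harmonic R).
rewrite mul0r in h; rewrite -[X in _ --> X](mulr0 (0 : R)).
by under eq_fun do rewrite expr2; exact: (cvgM h h).
Qed.

Lemma damped_nondecreasing k (x : R) : ~~ odd k ->
  nondecreasing_seq (fun n => damped R k (harmonic n) x).
Proof.
move=> ke m n mn; rewrite /damped ler_wpM2l ?exprn_even_ge0//.
rewrite lef_pV2 ?posrE ?damped_den_gt0// lerD2l !exprMn ler_wpM2r ?sqr_ge0//.
by rewrite ler_sqr ?nnegrE ?harmonic_ge0// lef_pV2 ?posrE ?ltr0n// ler_nat.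
Qed.

(** For even [k] the damped powers are nonnegative and increase to [x ^+ k]; by monotone
    convergence, a finite limit yields integrability as well as the value. *)
Lemma moment_damped_cvg k (m : R) : ~~ odd k ->
  (forall n, sigma.-integrable setT (EFin \o damped R k (harmonic n))) ->
  damped_moment R sigma k (harmonic n) @[n --> \oo] --> m ->
  integrableX k /\ moment sigma k = m.
Proof.
move=> ke id cm.
have I : (\int[sigma]_x (x ^+ k)%:E = m%:E)%E.
  have E (f : nat -> R) (l : R) : f n @[n --> \oo] --> l ->
      (f n)%:E @[n --> \oo] --> l%:E by move=> fl; exact: (cvg_comp _ _ fl).
  have := @cvg_monotone_convergence _ (measurableTypeR R) R sigma setT
    measurableT (fun n x => (damped R k (harmonic n) x)%:E).
  move=> /(_ _ _ _) cvI.
  have {}cvI : (\int[sigma]_x (damped R k (harmonic n) x)%:E)%E @[n --> \oo] -->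
      (\int[sigma]_x (x ^+ k)%:E)%E.
    rewrite (eq_integral (fun x : measurableTypeR R =>
      limn (fun n => (damped R k (harmonic n) x)%:E))); last first.
      by move=> x _; apply/esym/cvg_lim => //; apply: E; exact: damped_cvg.
    apply: cvI.
    - by move=> n; apply/measurable_EFinP; exact: damped_measurable.
    - move=> n x _; rewrite lee_fin divr_ge0 ?exprn_even_ge0//.
      by rewrite ltW ?damped_den_gt0.
    - by move=> x _ n p np; rewrite lee_fin damped_nondecreasing.
  apply: (@cvg_unique _ (@ereal_hausdorff R) _ _ _ _ cvI).
  rewrite (_ : (fun n => _) =
    fun n => (damped_moment R sigma k (harmonic n))%:E).
    exact: E.
  apply/funext => n; rewrite /damped_moment /Rintegral fineK//.
  exact: (integrable_fin_num measurableT (id n)).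
split.
  apply/integrableP; split.
    by apply/measurable_EFinP; exact: exprn_measurable.
  rewrite (eq_integral (fun x : measurableTypeR R => (x ^+ k)%:E)) ?I ?ltry//.
  by move=> x _; rewrite gee0_abs// lee_fin exprn_even_ge0.
by rewrite /moment /Rintegral I.
Qed.

(* The integral of [x ^+ k / (1 + i t x)] against [sigma]; for [k = 0] and
   [zeta = i / t] it is [zeta * cauchyG sigma zeta]. *)
Definition resolvent_moment k t : R[i] :=
  damped_moment R sigma k t +i* (- (t * damped_moment R sigma k.+1 t)).

(** Pointwise, [1 / (i / t - x) = (- i t) / (1 + i t x)]. *)
Lemma cauchyG_imag (t : R) : 0 < t ->
  cauchyG sigma (0 +i* t^-1) = (0 +i* (- t)) * resolvent_moment 0 t.
Proof.
move=> t0; have i0 : sigma.-integrable setT (fun x : R => (x ^+ 0)%:E).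
  by have := finite_measure_integrable_cst sigma 1 measurableT.
have tN0 : t != 0 by rewrite gt_eqF.
have den (x : R) : (0 - x) ^+ 2 + (t^-1 - 0) ^+ 2 = t ^- 2 * (1 + (t * x) ^+ 2).
  by field.
have dN0 (x : R) : 1 + (t * x) ^+ 2 != 0 by rewrite gt_eqF// damped_den_gt0.
rewrite /cauchyG /cintegral.
rewrite (_ : (fun x : R => complex.Re _) =
  fun x => - t ^+ 2 * damped R 1 t x); last first.
  apply/funext => x; rewrite /damped expr1 /= den.
  move: (1 + (t * x) ^+ 2) (dN0 x) => d dx; field.
  exact/andP.
rewrite (_ : (fun x : R => complex.Im _) =
  fun x => - t * damped R 0 t x); last first.
  apply/funext => x; rewrite /damped expr0 /= den.
  move: (1 + (t * x) ^+ 2) (dN0 x) => d dx; field.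
  exact/andP.
rewrite RintegralZl//; last exact: integrable_dampedS.
rewrite RintegralZl//; last exact: integrable_damped.
rewrite /resolvent_moment; apply/eqP; rewrite eq_complex /=.
apply/andP; split; apply/eqP.
  by rewrite /damped_moment; ring.
by rewrite /damped_moment; ring.
Qed.

(** Integrate [x^k / (1 + i t x) = x^k - i t x^(k+1) / (1 + i t x)]: one more term of the expansion
    in [1 / zeta]. *)
Lemma resolvent_momentE k t : 0 < t -> integrableX k ->
  resolvent_moment k t =
  (moment sigma k)%:C + (0 +i* (- t)) * resolvent_moment k.+1 t.
Proof.
move=> t0 ik; rewrite (damped_momentE _ _ _ _ t0 ik).
apply/eqP; rewrite eq_complex /=; apply/andP; split; apply/eqP; ring.
Qed.

Lemma normc_le_ReIm (z : R[i]) : `|z| <= (`|complex.Re z| + `|complex.Im z|)%:C.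
Proof.
rewrite normc_def lecR -[leRHS]ger0_norm ?addr_ge0// -sqrtr_sqr.
rewrite ler_wsqrtr// -(real_normK (num_real (complex.Re z))).
rewrite -(real_normK (num_real (complex.Im z))) sqrrD.
by rewrite addrAC lerDl mulrn_wge0// mulr_ge0.
Qed.

Lemma resolvent_moment_le k t : 0 < t -> integrableX k ->
  `|resolvent_moment k t| <= (2 * abs_moment R sigma k)%:C.
Proof.
move=> t0 ik; apply: le_trans (normc_le_ReIm _) _.
rewrite lecR mulrDl !mul1r lerD//=; first exact: damped_moment_le.
by rewrite normrN normrM gtr0_norm// damped_momentS_le.
Qed.

End Limit.

(** * Orders of vanishing at 0 from the right *)

Section BigO.
Variable R : realType.
Implicit Types (f g : R -> R[i]) (n : nat).

Definition bigOX n f :=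
  exists2 c : R, 0 <= c & \forall t \near 0^'+, `|f t| <= (c * t ^+ n)%:C.

Lemma bigOXD n f g : bigOX n f -> bigOX n g -> bigOX n (fun t => f t + g t).
Proof.
move=> [c c0 hf] [d d0 hg]; exists (c + d); first exact: addr_ge0.
near=> t; apply: le_trans (ler_normD _ _) _.
by rewrite mulrDl rmorphD lerD//; near: t.
Unshelve. all: by end_near. Qed.

Lemma bigOXM n m f g : bigOX n f -> bigOX m g ->
  bigOX (n + m) (fun t => f t * g t).
Proof.
move=> [c c0 hf] [d d0 hg]; exists (c * d); first exact: mulr_ge0.
near=> t; rewrite exprD mulrACA rmorphM normrM.
by apply: ler_pM => //; near: t.
Unshelve. all: by end_near. Qed.

Lemma bigOX_near n f g : (\forall t \near 0^'+, f t = g t) ->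
  bigOX n f -> bigOX n g.
Proof.
move=> fg [c c0 hf]; exists c => //.
near=> t; rewrite (_ : g t = f t); first by near: t.
by apply/esym; near: t.
Unshelve. all: by end_near. Qed.

Lemma bigOX_cst (z : R[i]) : bigOX 0 (fun=> z).
Proof.
exists (`|complex.Re z| + `|complex.Im z|); first by rewrite addr_ge0.
by near=> t; rewrite expr0 mulr1 normc_le_ReIm.
Unshelve. all: by end_near. Qed.

(* [1 / zeta] at [zeta = i / t]. *)
Definition zinv (t : R) : R[i] := 0 +i* (- t).

Lemma norm_zinv t : 0 < t -> `|zinv t| = t%:C.
Proof.
by move=> t0; rewrite normc_def /= expr0n add0r sqrrN sqrtr_sqr gtr0_norm.
Qed.

Lemma bigOX_zinv n : bigOX n (fun t => zinv t ^+ n).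
Proof.
exists 1 => //; near=> t; have t0 : 0 < t by near: t; exact: nbhs_right_gt.
by rewrite normrX norm_zinv// mul1r rmorphXn.
Unshelve. all: by end_near. Qed.

Lemma bigOX_div n f : bigOX n.+1 (fun t => zinv t * f t) -> bigOX n f.
Proof.
move=> [c c0 h]; exists c => //.
near=> t; have t0 : 0 < t by near: t; exact: nbhs_right_gt.
have : `|zinv t * f t| <= (c * t ^+ n.+1)%:C by near: t.
rewrite normrM norm_zinv// exprS mulrCA rmorphM.
by rewrite ler_pM2l// ltcR.
Unshelve. all: by end_near. Qed.

Lemma bigOX_sum n m (F : nat -> R -> R[i]) : (forall i, bigOX n (F i)) ->
  bigOX n (fun t => \sum_(i < m) F i t).
Proof.
move=> hF; elim: m => [|m IH].
  apply: (bigOX_near n (fun=> 0)); first by near=> t; rewrite big_ord0.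
  exists 0 => //; near=> t; by rewrite normr0 mul0r.
apply: bigOX_near (bigOXD _ _ _ IH (hF m)).
by near=> t; rewrite big_ord_recr.
Unshelve. all: by end_near. Qed.

(** Such an [f] tends to 1, so it stays away from 0; this permits the divisions in
    [boolean_expansion]. *)
Lemma bigOX1_norm_ge f : bigOX 1 (fun t => f t - 1) ->
  \forall t \near 0^'+, 2^-1 <= `|f t|.
Proof.
move=> [c c0 h].
have hc : \forall t \near (0 : R)^'+, c * t <= 2^-1.
  have [->|cN0] := eqVneq c 0.
    by near=> t; rewrite mul0r invr_ge0.
  have cp : 0 < c by rewrite lt0r cN0.
  near=> t; rewrite -ler_pdivlMl//; near: t; apply: nbhs_right_le.
  by rewrite mulr_gt0// invr_gt0.
near=> t.
have h1 : `|f t - 1| <= (2^-1)%:C.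
  apply: le_trans (_ : (c * t ^+ 1)%:C <= _); first by near: t.
  by rewrite lecR expr1; near: t.
have e : (2^-1)%:C = 2^-1 :> R[i] by rewrite fmorphV rmorph_nat.
rewrite -e; have := ler_distD (f t) 1 0; rewrite subr0 normr1 subr0 => h2.
rewrite -(lerD2l `|1 - f t|); apply: le_trans h2.
rewrite distrC; apply: le_trans (lerD h1 (lexx _)) _.
by rewrite -rmorphD lecR; lra.
Unshelve. all: by end_near. Qed.
End BigO.

(** Only degrees below [n] occur, so that the matching remainder is [O(t^n)]. *)
Definition zinv_poly (R : realType) (m : nat -> R) n t : R[i] :=
  \sum_(j < n) (m j)%:C * zinv R t ^+ j.

Lemma zinv_poly_recl (R : realType) (m : nat -> R) n t :
  zinv_poly R m n.+1 t = (m 0%N)%:C + zinv R t * zinv_poly R (m \o succn) n t.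
Proof.
rewrite /zinv_poly big_ord_recl expr0 mulr1 mulr_sumr; congr (_ + _).
by apply: eq_bigr => j _; rewrite exprS mulrCA.
Qed.

(** * Asymptotic expansion of the Cauchy transform *)

Section Expansion.
Variables (R : realType) (sigma : probability (measurableTypeR R) R).
Hypothesis sigma_moments : finite_moments sigma.
Local Notation E := (resolvent_moment R sigma).

Lemma bigOX_resolvent_moment k :
  sigma.-integrable setT (fun x : R => (x ^+ k)%:E) ->
  bigOX R 0 (E k).
Proof.
move=> ik; exists (2 * abs_moment R sigma k).
  by rewrite mulr_ge0// abs_moment_ge0.
near=> t; have t0 : 0 < t by near: t; exact: nbhs_right_gt.
by rewrite expr0 mulr1 resolvent_moment_le.
Unshelve. all: by end_near. Qed.

Variables (w s : nat -> R).
Hypothesis ws : forall n, s n = \sum_(j < n.+1) moment sigma (n - j) * w j.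

(** Exact finite form of the product of the moment series with the series of [w]: in the term of
    degree [j], [E 0] is unrolled [n - j] times, which leaves [E (n - j)]. *)
Lemma resolvent_moment_mul n t : 0 < t ->
  E 0 t * zinv_poly R w n t = zinv_poly R s n t +
    zinv R t ^+ n * \sum_(j < n) (w j)%:C * E (n - j) t.
Proof.
move=> t0; elim: n => [|n IH].
  by rewrite /zinv_poly !big_ord0 !mulr0 addr0.
rewrite {1}/zinv_poly big_ord_recr mulrDr -/(zinv_poly R w n t) IH.
rewrite [X in _ = X + _]/zinv_poly big_ord_recr -/(zinv_poly R s n t) /=.
rewrite -!addrA.
congr (_ + _).
(* The new term of [zinv_poly R w] is the term [j = n] of the remainder. *)
transitivity (zinv R t ^+ n * \sum_(j < n.+1) (w j)%:C * E (n - j) t).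
  by rewrite big_ord_recr /= subnn; ring.
transitivity (zinv R t ^+ n * ((s n)%:C +
    zinv R t * \sum_(j < n.+1) (w j)%:C * E (n.+1 - j) t)); last first.
  by rewrite exprSr; ring.
congr (_ * _).
(* Unrolling every [E (n - j)] once more produces the moments that make up [s n]. *)
rewrite ws raddf_sum mulr_sumr -big_split; apply: eq_bigr => j _ /=.
have jn : (j <= n)%N by rewrite -ltnS.
rewrite (resolvent_momentE _ _ (n - j) t t0) // ?subSn//.
by rewrite mulrDr rmorphM mulrC; congr (_ + _); rewrite mulrCA.
Qed.

Lemma resolvent_expansion n :
  bigOX R n (fun t => E 0 t * zinv_poly R w n t - zinv_poly R s n t).
Proof.
apply: (bigOX_near R n (fun t =>
    zinv R t ^+ n * \sum_(j < n) (w j)%:C * E (n - j) t)).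
  near=> t; rewrite resolvent_moment_mul; last by near: t; exact: nbhs_right_gt.
  by rewrite addrC addKr.
rewrite -[X in bigOX _ X](addn0 n); apply: bigOXM; first exact: bigOX_zinv.
apply: (bigOX_sum R 0 n (fun j t => (w j)%:C * E (n - j) t)) => j.
apply: (bigOXM R 0 0); first exact: bigOX_cst.
exact/bigOX_resolvent_moment/sigma_moments.
Unshelve. all: by end_near. Qed.

Lemma bigOX_resolvent_sub1 : bigOX R 1 (fun t => E 0 t - 1).
Proof.
apply: (bigOX_near R 1 (fun t => zinv R t ^+ 1 * E 1 t)).
  near=> t; have t0 : 0 < t by near: t; exact: nbhs_right_gt.
  rewrite [in RHS](resolvent_momentE _ _ _ _ t0 (sigma_moments 0)).
  by rewrite moment0 addrC addKr expr1.
apply: (bigOXM R 1 0); first exact: bigOX_zinv.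
exact/bigOX_resolvent_moment/sigma_moments.
Unshelve. all: by end_near. Qed.

End Expansion.

(** * Expansion of the boolean convolution *)

Section BooleanExpansion.
Variables (R : realType) (mu nu rho : probability (measurableTypeR R) R).
Hypotheses (mu_moments : finite_moments mu) (nu_moments : finite_moments nu).
Hypothesis boolean_conv : boolean_convolution mu nu rho.
Variables u v m : nat -> R.
Hypothesis m_def : forall n, m n = u n + v n - (n == 0%N)%:R.
Hypothesis mu_u : forall n, m n = \sum_(j < n.+1) moment mu (n - j) * u j.
Hypothesis nu_v : forall n, m n = \sum_(j < n.+1) moment nu (n - j) * v j.
Local Notation F := (resolvent_moment R mu 0).
Local Notation G := (resolvent_moment R nu 0).
Local Notation H := (resolvent_moment R rho 0).

(** At [zeta = i / t], [boolK mu] is [zeta (1 - 1 / F)], and likewise for [nu] and [rho]; divide the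
    additivity of [boolK] by [zeta]. *)
Lemma boolean_resolvent t : 0 < t -> (H t)^-1 = (F t)^-1 + (G t)^-1 - 1.
Proof.
move=> t0; have := boolean_conv (0 +i* t^-1); rewrite /= invr_gt0 => /(_ t0).
rewrite /boolK !cauchyG_imag// -/(zinv R t).
have N0 : zinv R t != 0 by rewrite -normr_eq0 norm_zinv// gt_eqF// ltcR.
have -> : 0 +i* t^-1 = (zinv R t)^-1.
  apply: (mulfI N0); rewrite mulfV//; apply/eqP; rewrite eq_complex /=.
  by apply/andP; split; apply/eqP; field; rewrite ?gt_eqF.
move: (F t) (G t) (H t) => a b c; rewrite !invfM => e.
apply: (mulfI (_ : (zinv R t)^-1 != 0)); first by rewrite invr_eq0.
by apply/eqP; rewrite -subr_eq0; move/eqP: e; rewrite -subr_eq0 => /eqP e;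
  apply/eqP; rewrite -[RHS]oppr0 -e; ring.
Qed.

(** The length is [n.+1] because the constant [- 1] belongs to the term of index 0. *)
Lemma zinv_poly_relation n t :
  zinv_poly R m n.+1 t = zinv_poly R u n.+1 t + zinv_poly R v n.+1 t - 1.
Proof.
rewrite !zinv_poly_recl m_def rmorphB rmorphD rmorph1 /=.
suff -> : zinv_poly R (m \o succn) n t =
    zinv_poly R (u \o succn) n t + zinv_poly R (v \o succn) n t by ring.
rewrite /zinv_poly -big_split; apply: eq_bigr => j _ /=.
by rewrite m_def subr0 rmorphD mulrDl.
Qed.

Lemma boolean_expansion n : bigOX R n (fun t => H t - zinv_poly R m n t).
Proof.
case: n => [|n].
  apply: (bigOX_near R 0 H).
    by near=> t; rewrite /zinv_poly big_ord0 subr0.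
  apply: bigOX_resolvent_moment.
  exact: (finite_measure_integrable_cst rho 1 measurableT).
(* By [boolean_resolvent], [H = F G / D]; since [D - 1 = - (F - 1) (G - 1)], [D] tends to 1. *)
pose D t := F t + G t - F t * G t.
have D1 : bigOX R 1 (fun t => D t - 1).
  apply: (bigOX_near R 1 (fun t => - 1 * ((F t - 1) * (G t - 1)))).
    by near=> t; rewrite /D; ring.
  apply: (bigOXM R 0 1); first exact: bigOX_cst.
  have h := bigOXM R 0 1 _ _ _ (bigOX_resolvent_sub1 R nu nu_moments).
  apply: h.
  by apply: bigOXD; [exact/bigOX_resolvent_moment/mu_moments|exact: bigOX_cst].
have DV : bigOX R 0 (fun t => (D t)^-1).
  exists 2 => //; near=> t.
  have h : 2^-1 <= `|D t| by near: t; exact: bigOX1_norm_ge.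
  rewrite expr0 mulr1 normfV rmorph_nat invf_ple// ?posrE//.
  exact: lt_le_trans h.
(* For the truncated series, [M = U + V - 1] turns [N] into [F G - M D = D (H - M)]; its brackets
   are errors of [resolvent_expansion]. *)
pose N t := (G t * zinv_poly R v n.+1 t - zinv_poly R m n.+1 t) * F t +
            (F t * zinv_poly R u n.+1 t - zinv_poly R m n.+1 t) * G t.
have HN : bigOX R n.+1 N.
  rewrite -[X in bigOX _ X](addn0 n.+1); apply: bigOXD; apply: bigOXM.
  - exact: resolvent_expansion.
  - exact/bigOX_resolvent_moment/mu_moments.
  - exact: resolvent_expansion.
  - exact/bigOX_resolvent_moment/nu_moments.
apply: (bigOX_near R n.+1 (fun t => N t * (D t)^-1)); last first.
  by rewrite -[X in bigOX _ X](addn0 n.+1); exact: bigOXM.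
near=> t.
have half0 : 0 < 2^-1 :> R[i] by [].
have F0 : F t != 0.
  rewrite -normr_gt0; apply: lt_le_trans half0 _.
  by near: t; apply: bigOX1_norm_ge; exact: bigOX_resolvent_sub1.
have G0 : G t != 0.
  rewrite -normr_gt0; apply: lt_le_trans half0 _.
  by near: t; apply: bigOX1_norm_ge; exact: bigOX_resolvent_sub1.
have D0 : D t != 0.
  rewrite -normr_gt0; apply: lt_le_trans half0 _.
  by near: t; apply: bigOX1_norm_ge.
have HE : H t = F t * G t / D t.
  rewrite -[LHS]invrK boolean_resolvent; last by near: t; exact: nbhs_right_gt.
  rewrite -[RHS]invrK; congr (_^-1); rewrite invfM invrK /D; field.
  by rewrite F0 G0.
apply: (mulIf D0); rewrite divfK// HE mulrBl divfK//.
by rewrite /N /D zinv_poly_relation; ring.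
Unshelve. all: by end_near. Qed.

End BooleanExpansion.

Lemma near0_le0 (R : realType) (a b : R) :
  (\forall t \near 0^'+, a <= b * t) -> a <= 0.
Proof.
move=> h; rewrite leNgt; apply/negP => a0.
have b0 : 0 < `|b| + 1 by rewrite ltr_pwDr.
have : \forall t \near (0 : R)^'+, false.
  near=> t.
  have t0 : 0 < t by near: t; exact: nbhs_right_gt.
  have : a <= b * t by near: t.
  rewrite leNgt => /negP[].
  apply: (@le_lt_trans _ _ (`|b| * t)).
    by rewrite ler_wpM2r ?ler_norm// ltW.
  apply: (@lt_le_trans _ _ ((`|b| + 1) * t)); first by rewrite ltr_pM2r// ltrDl.
  rewrite -ler_pdivlMl//; near: t; apply: nbhs_right_le.
  by rewrite mulr_gt0// invr_gt0.
by move/filter_ex => -[].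
Unshelve. all: by end_near. Qed.

Lemma normc_ge_Im (R : rcfType) (z : R[i]) : `|complex.Im z|%:C <= `|z|.
Proof.
rewrite normc_def lecR -sqrtr_sqr ler_wsqrtr//.
by rewrite lerDr sqr_ge0.
Qed.

(** * Recovering the moments from the expansion *)

Section MomentsFromExpansion.
Variables (R : realType) (rho : probability (measurableTypeR R) R).
Local Notation integrableX k :=
  (rho.-integrable setT (fun x : R => (x ^+ k)%:E)).
Local Notation E := (resolvent_moment R rho).
Local Notation expansion k s := (forall n,
  bigOX R n (fun t => E k t - zinv_poly R s n t)).

(** Subtract the constant term, which is the moment, and divide by [zinv]; this costs one order,
    hence the use of order [n.+1]. *)
Lemma resolvent_expansionS k (s : nat -> R) : integrableX k ->
  moment rho k = s 0%N ->
  expansion k s -> expansion k.+1 (s \o succn).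
Proof.
move=> ik mk es n; apply: bigOX_div; apply: bigOX_near (es n.+1).
near=> t; have t0 : 0 < t by near: t; exact: nbhs_right_gt.
rewrite zinv_poly_recl (resolvent_momentE _ _ _ _ t0 ik) mk -/(zinv R t).
by ring.
Unshelve. all: by end_near. Qed.

(** Take real and imaginary parts of the expansion of order 2. The imaginary part carries a factor
    [t], so one order is lost in the second bound. *)
Lemma expansion_damped_moment k (s : nat -> R) : expansion k s ->
  exists2 c : R, 0 <= c & \forall t \near 0^'+,
    `|damped_moment R rho k t - s 0%N| <= c * t ^+ 2 /\
    `|damped_moment R rho k.+1 t - s 1%N| <= c * t.
Proof.
move=> /(_ 2%N) [c c0 h]; exists c => //.
near=> t; have t0 : 0 < t by near: t; exact: nbhs_right_gt.
have h2 : `|E k t - zinv_poly R s 2 t| <= (c * t ^+ 2)%:C by near: t.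
have eR : complex.Re (E k t - zinv_poly R s 2 t) =
    damped_moment R rho k t - s 0%N.
  by rewrite !zinv_poly_recl /zinv_poly big_ord0 /=; ring.
have eI : complex.Im (E k t - zinv_poly R s 2 t) =
    - (t * (damped_moment R rho k.+1 t - s 1%N)).
  by rewrite !zinv_poly_recl /zinv_poly big_ord0 /=; ring.
split.
  by rewrite -eR -lecR; apply: le_trans h2; exact: normc_ge_Re.
rewrite -(ler_pM2l t0) -{1}(gtr0_norm t0) -normrM -normrN -eI -lecR.
by rewrite mulrCA -expr2; apply: le_trans h2; exact: normc_ge_Im.
Unshelve. all: by end_near. Qed.

(** Multiply [|x| <= 1 + x^2] by [|x^k|]. *)
Lemma integrableX_between k : integrableX k -> integrableX k.+2 ->
  integrableX k.+1.
Proof.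
move=> i0 i2.
have := integrableD measurableT (integrable_abse i0) (integrable_abse i2).
apply: le_integrable => //.
  by apply/measurable_EFinP; exact: exprn_measurable.
move=> x _; change (`|x ^+ k.+1|%:E <= `| `|x ^+ k| + `|x ^+ k.+2| |%:E)%E.
rewrite lee_fin [leRHS]ger0_norm ?addr_ge0//.
rewrite !exprS !normrM.
have := normr_ge0 (x ^+ k); have := sqr_ge0 (`|x| - 1).
by move: (`|x|) (`|x ^+ k|) => a b; nra.
Qed.

(** Monotone convergence needs an even exponent, so [k.+2] is treated first, by the limit of its
    damped moments along [harmonic]; integrability at the odd exponent [k.+1] then follows. *)
Lemma expansion_step k (s : nat -> R) : ~~ odd k -> integrableX k ->
  moment rho k = s 0%N -> expansion k s ->
  [/\ integrableX k.+1, integrableX k.+2, moment rho k.+1 = s 1%N,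
     moment rho k.+2 = s 2%N & expansion k.+2 (s \o succn \o succn)].
Proof.
move=> ke ik mk es; have es1 := resolvent_expansionS k s ik mk es.
have [c c0 h] := expansion_damped_moment _ _ es1.
have hn : \forall n \near \oo,
    `|damped_moment R rho k.+2 (harmonic n) - s 2%N| <= c * harmonic n.
  have hd : \forall t \near (0:R), 0 < t ->
      `|damped_moment R rho k.+2 t - s 2%N| <= c * t.
    by move: h; rewrite near_withinE; apply: filterS => t ht /ht[].
  have hd' : \forall n \near \oo, (0 : R) < harmonic n ->
    `|damped_moment R rho k.+2 (harmonic n) - s 2%N| <= c * harmonic n.
    exact: (@cvg_harmonic R _ hd).
  by apply: filterS hd' => n; apply; exact: harmonic_gt0.
have [i2 m2] : integrableX k.+2 /\ moment rho k.+2 = s 2%N.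
  apply: moment_damped_cvg; first by rewrite /= negbK.
    by move=> n; apply: integrable_dampedSS => //; exact: harmonic_gt0.
  apply/subr_cvg0/norm_cvg0P.
  apply: (@squeeze_cvgr _ _ _ _ (cst 0) (fun n => c * harmonic n)).
  - by apply: filterS hn => n ->; rewrite normr_ge0.
  - exact: cvg_cst.
  - by rewrite -[X in _ --> X](mulr0 c); apply: cvgMr; exact: cvg_harmonic.
have i1 := integrableX_between k ik i2.
have m1 : moment rho k.+1 = s 1%N.
  apply/eqP; rewrite -subr_eq0 -normr_le0.
  (* By [damped_momentE] the difference splits into the expansion error, at most [c t^2 <= c t], and
     [t^2] times the damped moment of order [k.+3], at most [t] times [abs_moment R rho k.+2]. *)
  apply: (near0_le0 _ _ (c + abs_moment R rho k.+2)).
  near=> t; have t0 : 0 < t by near: t; exact: nbhs_right_gt.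
  have t1 : t <= 1 by near: t; exact: nbhs_right_le.
  have [h1 _] : `|damped_moment R rho k.+1 t - s 1%N| <= c * t ^+ 2 /\
    `|damped_moment R rho k.+2 t - s 2%N| <= c * t by near: t.
  rewrite (damped_momentE _ _ _ t)// addrAC; apply: le_trans (ler_normD _ _) _.
  rewrite mulrDl; apply: lerD.
    apply: le_trans h1 _; rewrite ler_wpM2l// expr2 ler_piMr// ltW//.
  rewrite expr2 -mulrA normrM (gtr0_norm t0) [leRHS]mulrC ler_wpM2l ?(ltW t0)//.
  by rewrite normrM (gtr0_norm t0) damped_momentS_le.
split=> //; apply: (resolvent_expansionS k.+1 (s \o succn)) => //.
Unshelve. all: by end_near. Qed.

Lemma moments_of_expansion (s : nat -> R) : s 0%N = 1 -> expansion 0 s ->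
  forall k, integrableX k /\ moment rho k = s k.
Proof.
move=> s0 es.
(* The induction runs over even exponents and carries the shifted expansion; an odd exponent is
   reached from its even predecessor. *)
have P j : [/\ integrableX j.*2, moment rho j.*2 = s j.*2 &
    expansion j.*2 (fun n => s (j.*2 + n)%N)].
  elim: j => [|j [i0 m0 ej]].
    split=> //; first exact: (finite_measure_integrable_cst rho 1 measurableT).
    by rewrite moment0.
  have m0' : moment rho j.*2 = s (j.*2 + 0)%N by rewrite addn0.
  have ke : ~~ odd j.*2 by rewrite odd_double.
  have [_ i2 _ m2 e2] := expansion_step _ _ ke i0 m0' ej.
  split=> //; first by rewrite m2 addn2.
  rewrite (_ : (fun n => _) =
    (fun n => s (j.*2 + n)%N) \o succn \o succn)//.
  by apply/funext => n /=; rewrite doubleS !addnS !addSn.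
move=> k; rewrite -(odd_double_half k).
have [i0 m0 ej] := P k./2; case: (odd k) => //.
have m0' : moment rho (k./2).*2 = s ((k./2).*2 + 0)%N by rewrite addn0.
have ke : ~~ odd (k./2).*2 by rewrite odd_double.
have [i1 _ m1 _ _] := expansion_step _ _ ke i0 m0' ej.
by rewrite add1n; split=> //; rewrite m1 addn1.
Qed.

End MomentsFromExpansion.

(** * The filtered convolution on [z^n] and [w^n] *)

Theorem proposition3p5 (R : realType)
    (mu nu : probability (measurableTypeR R) R)
    (mu_moments : finite_moments mu) (nu_moments : finite_moments nu) :
  (finite_moments (classical_convolution mu nu) /\
   forall n : nat,
     fconv (hat mu) (hat nu) (wordX R[i] (nseq n Gz)) =
       (moment (classical_convolution mu nu) n)%:C) /\
  (forall rho : probability (measurableTypeR R) R,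
     boolean_convolution mu nu rho ->
     finite_moments rho /\
     forall n : nat,
       fconv (hat mu) (hat nu) (wordX R[i] (nseq n Gw)) =
         (moment rho n)%:C).
Proof.
split.
  split; first exact: finite_moments_convolution.
  by move=> n; rewrite fconv_z moment_convolution.
move=> rho conv.
have [u [v [u0 wE mu_u nu_v]]] := fconv_w_real R mu nu.
(* The candidate moments of [rho]: by [wE], the values of the filtered convolution on [w^n]. *)
pose m n := u n + v n - (n == 0%N)%:R.
have m0 : m 0%N = 1 by rewrite /m mu_u big_ord1 moment0 u0 mulr1.
have P := moments_of_expansion R rho m m0
  (boolean_expansion R mu nu rho mu_moments nu_moments conv u v m
     (fun=> erefl) mu_u nu_v).
split; first by move=> k; have [] := P k.
by move=> n; rewrite wE; have [_ ->] := P n.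
Qed.
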